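(* Let $G$ be an infinite finitely generated elementary amenable group. Then $G$ admits an epimorphism onto a group $H$ that contains a normal subgroup isomorphic to $\mathbb{Z}^d$, for some $d\geq 1$, of finite index $i\geq 1$ in $H$, and for this $i$ all Nielsen graphs $N_n(G)$ with $n\geq \operatorname{rank}(G)+\log_2 i+1$ are nonamenable.
   Context: The class of elementary amenable groups is the smallest class of groups containing all finite groups and all abelian groups and closed under taking subgroups, quotients, extensions and direct limits. $\operatorname{rank}(G)$ is the minimal number of generators of $G$. Elementary Nielsen moves on $G^n$ are, for $1\le i,j\le n$, $i\ne j$: $R_{ij}^{\pm}$, replacing the entry $g_i$ by $g_ig_j^{\pm1}$; $L_{ij}^{\pm}$, replacing $g_i$ by $g_j^{\pm1}g_i$; and, for $1\le j\le n$, $I_j$, replacing $g_j$ by $g_j^{-1}$; all other entries are unchanged. For $n\ge \operatorname{rank}(G)$, the Nielsen graph $N_n(G)$ has as vertex set all $n$-tuples $(g_1,\dots,g_n)\in G^n$ with $\langle g_1,\dots,g_n\rangle=G$; from each vertex there is one edge for each elementary Nielsen move, joining the vertex to its image under the move (loops and multiple edges allowed; orientation disregarded). A locally finite connected graph $X$ of uniformly bounded degree is amenable if either $X$ is finite or $h(X):=\inf_{S}\frac{|\partial_X(S)|}{|S|}=0$, where the infimum is over all finite nonempty $S\subset V(X)$ and $\partial_X(S)$ is the set of edges connecting $S$ to its complement. A graph with several connected components is amenable if at least one of its connected components is amenable. Nonamenable means not amenable (so every connected component is nonamenable). *)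

(* Defs.v *)
From HB Require Import structures.
From Stdlib Require Import Relation_Operators.
From mathcomp Require Import all_boot all_order all_algebra.
From mathcomp Require Import finmap.
From mathcomp Require Import all_classical all_reals all_analysis.
Set Implicit Arguments.
Unset Strict Implicit.
Unset Printing Implicit Defensive.

Local Open Scope classical_set_scope.
Local Open Scope card_scope.
Local Open Scope group_scope.

Definition is_subgroup (G : groupType) (A : set G) : Prop :=
  A 1 /\ forall x y, A x -> A y -> A (x * y^-1).

Definition normal_subgroup (G : groupType) (N : set G) : Prop :=
  is_subgroup N /\ forall x y, N x -> N (y^-1 * x * y).

Definition left_cosets (G : groupType) (A : set G) : set (set G) :=
  [set [set x * a | a in A] | x in [set: G]].

Definition has_index (G : groupType) (A : set G) (i : nat) : Prop :=
  left_cosets A #= `I_i.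

(* An isomorphism from the additive group Z^d onto the subgroup A of the
   multiplicative group G. *)
Definition isomorphic_to_Zn (d : nat) (G : groupType) (A : set G) : Prop :=
  exists phi : 'rV[int]_d -> G,
    [/\ forall u v, phi (u + v)%R = phi u * phi v, injective phi &
        range phi = A].

Definition generated (G : groupType) (X : set G) : set G :=
  smallest (@is_subgroup G) X.

Definition generating_tuple (G : groupType) (n : nat)
  (g : {ffun 'I_n -> G}) : Prop := generated (range g) = [set: G].

Definition generated_by (G : groupType) (n : nat) : Prop :=
  exists g : {ffun 'I_n -> G}, generating_tuple g.

Definition finitely_generated (G : groupType) : Prop :=
  exists n, generated_by G n.

Definition generated_byb (G : groupType) : pred nat :=
  fun n => `[< generated_by G n >].

Lemma finitely_generatedW (G : groupType) :
  finitely_generated G -> exists n, generated_byb G n.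
Proof. by case=> n Gn; exists n; apply/asboolP. Qed.

(* The value 0 is junk when G is not finitely generated. *)
Definition rank (G : groupType) : nat :=
  if pselect (finitely_generated G) is left fg
  then ex_minn (finitely_generatedW fg) else 0%N.

Definition directed_preorder (I : Type) (le : I -> I -> Prop) : Prop :=
  [/\ inhabited I, forall i, le i i,
      forall i j k, le i j -> le j k -> le i k &
      forall i j, exists2 k, le i k & le j k].

Definition direct_system (I : Type) (le : I -> I -> Prop)
    (A : I -> groupType)
    (phi : forall i j, le i j -> {multiplicative A i -> A j}) : Prop :=
  [/\ directed_preorder le,
      forall i (ii : le i i) x, phi i i ii x = x &
      forall i j k (ij : le i j) (jk : le j k) (ik : le i k) x,
        phi j k jk (phi i j ij x) = phi i k ik x].

Definition cocone (I : Type) (le : I -> I -> Prop) (A : I -> groupType)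
    (phi : forall i j, le i j -> {multiplicative A i -> A j})
    (G : groupType) (psi : forall i, {multiplicative A i -> G}) : Prop :=
  forall i j (ij : le i j) x, psi j (phi i j ij x) = psi i x.

Definition direct_limit (I : Type) (le : I -> I -> Prop) (A : I -> groupType)
    (phi : forall i j, le i j -> {multiplicative A i -> A j})
    (G : groupType) (psi : forall i, {multiplicative A i -> G}) : Prop :=
  cocone phi psi /\
  forall (K : groupType) (chi : forall i, {multiplicative A i -> K}),
    cocone phi chi ->
    (exists u : {multiplicative G -> K}, forall i x, u (psi i x) = chi i x) /\
    (forall u v : {multiplicative G -> K},
      (forall i x, u (psi i x) = chi i x) ->
      (forall i x, v (psi i x) = chi i x) -> u =1 v).

Inductive elementary_amenable : groupType -> Prop :=
| ea_finite (G : groupType) :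
    finite_set [set: G] -> elementary_amenable G
| ea_abelian (G : groupType) :
    (forall x y : G, x * y = y * x) -> elementary_amenable G
| ea_subgroup (G H : groupType) (f : {multiplicative H -> G}) :
    injective f -> elementary_amenable G -> elementary_amenable H
| ea_quotient (G Q : groupType) (p : {multiplicative G -> Q}) :
    set_surj setT setT p -> elementary_amenable G -> elementary_amenable Q
| ea_extension (N G Q : groupType)
    (f : {multiplicative N -> G}) (p : {multiplicative G -> Q}) :
    injective f -> set_surj setT setT p -> range f = p @^-1` [set 1] ->
    elementary_amenable N -> elementary_amenable Q -> elementary_amenable G
| ea_direct_limit (I : Type) (le : I -> I -> Prop) (A : I -> groupType)
    (phi : forall i j, le i j -> {multiplicative A i -> A j})
    (G : groupType) (psi : forall i, {multiplicative A i -> G}) :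
    direct_system phi -> direct_limit phi psi ->
    (forall i, elementary_amenable (A i)) -> elementary_amenable G.

(* The sign s : bool stands for the exponent +1 (true) or -1 (false). *)
Inductive nielsen_move (n : nat) : Type :=
| move_R (i j : 'I_n) of i != j & bool
| move_L (i j : 'I_n) of i != j & bool
| move_I of 'I_n.

Definition spow (G : groupType) (s : bool) (x : G) : G :=
  if s then x else x^-1.

Definition apply_move (G : groupType) (n : nat) (m : nielsen_move n)
    (g : {ffun 'I_n -> G}) : {ffun 'I_n -> G} :=
  match m with
  | move_R i j _ s => [ffun k => if k == i then g i * spow s (g j) else g k]
  | move_L i j _ s => [ffun k => if k == i then spow s (g j) * g i else g k]
  | move_I j => [ffun k => if k == j then (g j)^-1 else g k]
  end.

Section MoveFinite.
Variable n : nat.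

Definition move_code : Type :=
  ({p : 'I_n * 'I_n | p.1 != p.2} * bool) * bool + 'I_n.

Definition move_encode (m : nielsen_move n) : move_code :=
  match m with
  | move_R i j ij s => inl (exist _ (i, j) ij, s, true)
  | move_L i j ij s => inl (exist _ (i, j) ij, s, false)
  | move_I j => inr j
  end.

Definition move_decode (c : move_code) : nielsen_move n :=
  match c with
  | inl (exist (i, j) ij, s, true) => move_R ij s
  | inl (exist (i, j) ij, s, false) => move_L ij s
  | inr j => move_I j
  end.

Lemma move_encodeK : cancel move_encode move_decode.
Proof. by case. Qed.

HB.instance Definition _ :=
  Finite.copy (nielsen_move n) (can_type move_encodeK).
End MoveFinite.

(* Loops and multiple edges are allowed; source and target only name the two
   ends of an edge, and nothing below depends on the orientation. *)
Record multigraph (V E : choiceType) := MultiGraph {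
  vertices : set V;
  edges : set E;
  source : E -> V;
  target : E -> V;
  edges_ends : forall e, edges e -> vertices (source e) /\ vertices (target e)
}.

Definition adjacent (V E : choiceType) (X : multigraph V E) (x y : V) : Prop :=
  exists e, [/\ edges X e, source X e = x & target X e = y].

Definition connected_to (V E : choiceType) (X : multigraph V E) : V -> V -> Prop :=
  clos_refl_sym_trans V (adjacent X).

Section Component.
Variables (V E : choiceType) (X : multigraph V E) (x : V).

Definition component_vertices : set V :=
  [set y | vertices X y /\ connected_to X x y].

Definition component_edges : set E :=
  [set e | edges X e /\ connected_to X x (source X e)].

Lemma component_ends e : component_edges e ->
  component_vertices (source X e) /\ component_vertices (target X e).
Proof.
move=> [Ee xe]; have [sV tV] := edges_ends Ee; split; split=> //.
by apply: rst_trans xe _; apply: rst_step; exists e.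
Qed.

Definition component : multigraph V E := MultiGraph component_ends.
End Component.

Definition edge_boundary (V E : choiceType) (X : multigraph V E)
    (S : {fset V}) : set E :=
  [set e | edges X e /\ (source X e \in S) != (target X e \in S)].

(* fset_set A is the finite set with the same elements as A if A is finite (and
   empty otherwise): the formula is meant for locally finite graphs. *)
Definition cheeger (R : realType) (V E : choiceType) (X : multigraph V E) : R :=
  inf [set (#|` fset_set (edge_boundary X S)|%:R / #|` S|%:R)%R |
        S in [set S : {fset V} | S != fset0%fset /\ [set` S] `<=` vertices X]].

(* Meant for connected graphs; the general case is the next definition. *)
Definition amenable_connected (R : realType) (V E : choiceType)
    (X : multigraph V E) : Prop :=
  finite_set (vertices X) \/ cheeger R X = 0%R.

Definition amenable (R : realType) (V E : choiceType)
    (X : multigraph V E) : Prop :=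
  exists2 x, vertices X x & amenable_connected R (component X x).

Section NielsenGraph.
Variables (G : groupType) (n : nat).

Lemma spow_subgroup (A : set G) s x : is_subgroup A -> A x -> A (spow s x).
Proof. by case=> A1 AB Ax; case: s => //=; rewrite -[x^-1]mul1g; apply: AB. Qed.

Lemma mul_subgroup (A : set G) x y : is_subgroup A -> A x -> A y -> A (x * y).
Proof.
move=> sA Ax Ay; rewrite -[y]invgK; apply: sA.2 => //.
exact: (@spow_subgroup A false y).
Qed.

Lemma apply_move_generating (m : nielsen_move n) (g : {ffun 'I_n -> G}) :
  generating_tuple g -> generating_tuple (apply_move m g).
Proof.
rewrite /generating_tuple /generated => gG; apply/seteqP; split=> // x _ A.
move=> [sA mA]; have : [set: G] x by []; rewrite -gG; apply; split=> // _ [k _ <-].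
have Am l : A (apply_move m g l) by apply: mA; exists l.
have AV y : A y -> A y^-1 by exact: (@spow_subgroup A false y).
case: m Am {mA} => [i j ij s|i j ij s|j] Am; have := Am k; rewrite ffunE.
- case: eqP => [-> Ai|//].
  have := Am j; rewrite ffunE eq_sym (negbTE ij) => Aj.
  by rewrite -[g i](mulgK (spow s (g j))); apply: sA.2 => //; apply: spow_subgroup.
- case: eqP => [-> Ai|//].
  have := Am j; rewrite ffunE eq_sym (negbTE ij) => Aj.
  rewrite -[g i](mulKg (spow s (g j))); apply: mul_subgroup => //.
  by apply: AV; apply: spow_subgroup.
- by case: eqP => [-> /AV|//]; rewrite invgK.
Qed.

Lemma nielsen_ends (e : {ffun 'I_n -> G} * nielsen_move n) :
  [set e | generating_tuple e.1] e ->
  [set g | generating_tuple g] e.1 /\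
  [set g | generating_tuple g] (apply_move e.2 e.1).
Proof. by move=> eG; split=> //; apply: apply_move_generating. Qed.

Definition nielsen_graph :
    multigraph {ffun 'I_n -> G} ({ffun 'I_n -> G} * nielsen_move n)%type :=
  @MultiGraph _ _ [set g | generating_tuple g] [set e | generating_tuple e.1]
    (fun e => e.1) (fun e => apply_move e.2 e.1) nielsen_ends.
End NielsenGraph.

(* Main.v *)
Require Import Defs.
From HB Require Import structures.
From mathcomp Require Import all_boot all_order all_algebra.
From mathcomp Require Import finmap.
From mathcomp Require Import all_classical all_reals all_analysis.
Set Implicit Arguments.
Unset Strict Implicit.
Unset Printing Implicit Defensive.
Local Open Scope classical_set_scope.
Local Open Scope ring_scope.

(** An infinite finitely generated elementary amenable group [G] has a subgroup
    [K] of finite index whose abelianization is infinite. This is shown for all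
    finitely generated infinite subquotients at once, by induction on the
    construction of [G]: in an extension either the image of the kernel has
    infinite index and one passes to the quotient, or it has finite index, is
    finitely generated, and one passes to the kernel. Dividing [G] by the core of
    the commutator subgroup of [K], and then by torsion, gives [H] and [N = Z^d]
    of index [i].

    For the second part, call a set [A] of tuples boundary bounded when
    [|S :&: A| <= C * |boundary of S|] for all finite [S]. This property passes
    to subsets, finite unions and preimages under Nielsen moves, and it holds for
    [A] if two moves map [A] into disjoint parts of [A]. If [x j1], [x j2] map to
    vectors [u], [v] of [N], the shears [(u + v, v)] and [(u, v + u)] are such
    moves where the [k]-th coordinates of [u] and [v] are positive; hence tuples
    with [u != 0] are boundary bounded, and multiplying by short words so are all
    generating tuples with [x j1], [x j2] mapped into [N]. Finally at most
    [log2 i] entries of a generating tuple generate [H / N], so two other entries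
    can be moved into [N] by multiplying them by short words: all generating
    tuples are boundary bounded, which is edge expansion. *)

(** * Homomorphisms, subgroups as groups, quotient groups *)

Section GroupBasics.
Local Open Scope group_scope.
Implicit Types G H : groupType.

Lemma multiplicative1 G H (f : {multiplicative G -> H}) : f 1 = 1.
Proof. by apply: (@mulgI _ (f 1)); rewrite -gmulfM !mulg1. Qed.

Lemma multiplicativeV G H (f : {multiplicative G -> H}) x : f x^-1 = (f x)^-1.
Proof. by apply: (@mulgI _ (f x)); rewrite -gmulfM !mulgV multiplicative1. Qed.

Lemma multiplicativeX G H (f : {multiplicative G -> H}) x n :
  f (x ^+ n) = f x ^+ n.
Proof.
by elim: n => [|n IH]; rewrite ?expg0n ?multiplicative1 // !expgS gmulfM IH.
Qed.

Lemma subgroupV G (A : set G) x : is_subgroup A -> A x -> A x^-1.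
Proof. exact: (@spow_subgroup _ A false). Qed.

Lemma subgroupX G (A : set G) x n : is_subgroup A -> A x -> A (x ^+ n).
Proof.
move=> sA Ax; elim: n => [|n IH]; first exact: sA.1.
by rewrite expgS; apply: mul_subgroup.
Qed.

Lemma is_subgroup_preimage G H (f : {multiplicative G -> H}) (A : set H) :
  is_subgroup A -> is_subgroup (f @^-1` A).
Proof.
move=> sA; split=> [|x y /= Ax Ay]; first by rewrite /= multiplicative1; exact: sA.1.
by rewrite gmulfM multiplicativeV; apply: sA.2.
Qed.

Lemma is_subgroup_image G H (f : {multiplicative G -> H}) (A : set G) :
  is_subgroup A -> is_subgroup (f @` A).
Proof.
move=> sA; split=> [|_ _ [x Ax <-] [y Ay <-]].
  by exists 1; [exact: sA.1|rewrite multiplicative1].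
by exists (x * y^-1); [exact: sA.2|rewrite gmulfM multiplicativeV].
Qed.

Lemma normal_subgroup_image G H (f : {multiplicative G -> H}) (A : set G) :
  set_surj setT setT f -> normal_subgroup A -> normal_subgroup (f @` A).
Proof.
move=> fsurj [sA nA]; split; first exact: is_subgroup_image.
move=> _ y [x Ax <-]; have [z _ <-] := fsurj y I.
by exists (z^-1 * x * z); [exact: nA|rewrite !gmulfM multiplicativeV].
Qed.

(** Membership is stored in Boolean form so that the subtype and choice structures apply; [sA] is a
    parameter so that the group structure can be inferred from the type. *)
Record subgroup_type G (A : set G) (sA : is_subgroup A) := SubgroupType {
  subgroup_val : G;
  _ : `[< A subgroup_val >] }.

HB.instance Definition _ G (A : set G) (sA : is_subgroup A) :=
  [isSub for @subgroup_val G A sA].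
HB.instance Definition _ G (A : set G) (sA : is_subgroup A) :=
  [Choice of subgroup_type sA by <:].

Fact subgroup_type_closed G (A : set G) (sA : is_subgroup A) :
  group_closed (fun x : G => `[< A x >]).
Proof.
split=> [|x y]; first by apply/asboolP; exact: sA.1.
by move=> /asboolP Ax /asboolP Ay; apply/asboolP; exact: sA.2.
Qed.

HB.instance Definition _ G (A : set G) (sA : is_subgroup A) :=
  SubChoice_isSubGroup.Build G (fun x => `[< A x >]) (subgroup_type sA)
    (subgroup_type_closed sA).

Lemma subgroup_inclusion G (A : set G) : is_subgroup A ->
  exists (H : groupType) (f : {multiplicative H -> G}),
    injective f /\ range f = A.
Proof.
move=> sA; exists (subgroup_type sA), (val : {multiplicative subgroup_type sA -> G}).
split; first exact: val_inj.
apply/seteqP; split=> [_ [x _ <-]|x Ax]; first exact/asboolP/(valP x).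
by exists (Sub x (introT (asboolP _) Ax)) => //; rewrite SubK.
Qed.

Section Quotient.
Variables (G : groupType) (N : set G) (nN : normal_subgroup N).

Definition eqmod of normal_subgroup N : rel G := fun x y => `[< N (x^-1 * y) >].

Fact eqmod_refl : reflexive (eqmod nN).
Proof. by move=> x; apply/asboolP; rewrite mulVg; exact: nN.1.1. Qed.

Fact eqmod_sym : symmetric (eqmod nN).
Proof.
by move=> x y; apply/asboolP/asboolP => /(subgroupV nN.1); rewrite invgM invgK.
Qed.

Fact eqmod_trans : transitive (eqmod nN).
Proof.
move=> y x z /asboolP xy /asboolP yz; apply/asboolP.
by rewrite -[x^-1](mulgK y) -mulgA; exact: mul_subgroup nN.1 xy yz.
Qed.

Canonical eqmod_equiv := EquivRel (eqmod nN) eqmod_refl eqmod_sym eqmod_trans.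

Local Open Scope quotient_scope.

Definition quotient_type := {eq_quot eqmod_equiv}.

HB.instance Definition _ := Choice.on quotient_type.

Let class (x : G) : quotient_type := \pi_{eq_quot eqmod_equiv} x.

Let classP x y : class x = class y <-> N (x^-1 * y).
Proof.
split=> [/eqmodP/asboolP//|Nxy]; exact/eqmodP/asboolP.
Qed.

Let class_repr (x : quotient_type) : class (repr x) = x.
Proof. exact: reprK. Qed.

Let quotient_one := class 1.
Let quotient_mul (x y : quotient_type) := class (repr x * repr y).
Let quotient_inv (x : quotient_type) := class (repr x)^-1.

Let class_mul x y : quotient_mul (class x) (class y) = class (x * y).
Proof.
apply/classP; have /classP Nx := class_repr (class x).
have /classP Ny := class_repr (class y).
set x' := repr _ in Nx *; set y' := repr _ in Ny *.
have -> : (x' * y')^-1 * (x * y) = (y'^-1 * (x'^-1 * x) * y') * (y'^-1 * y).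
  by rewrite invgM !mulgA mulgK.
by apply: mul_subgroup nN.1 _ Ny; exact: nN.2.
Qed.

Let class_inv x : quotient_inv (class x) = class x^-1.
Proof.
apply/classP; have /classP/(subgroupV nN.1) Nx := class_repr (class x).
set x' := repr _ in Nx *.
have -> : x'^-1^-1 * x^-1 = x'^-1^-1 * (x^-1 * x') * x'^-1.
  by rewrite !invgK !mulgA mulgK.
by apply: nN.2; rewrite invgM invgK in Nx.
Qed.

Let quotient_mulA : associative quotient_mul.
Proof.
move=> x y z; rewrite -[x]class_repr -[y]class_repr -[z]class_repr.
by rewrite !class_mul mulgA.
Qed.
Let quotient_mul1g : left_id quotient_one quotient_mul.
Proof. by move=> x; rewrite -[x]class_repr class_mul mul1g. Qed.
Let quotient_mulg1 : right_id quotient_one quotient_mul.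
Proof. by move=> x; rewrite -[x]class_repr class_mul mulg1. Qed.
Let quotient_mulVg : left_inverse quotient_one quotient_inv quotient_mul.
Proof. by move=> x; rewrite -[x]class_repr class_inv class_mul mulVg. Qed.
Let quotient_mulgV : right_inverse quotient_one quotient_inv quotient_mul.
Proof. by move=> x; rewrite -[x]class_repr class_inv class_mul mulgV. Qed.

HB.instance Definition _ := isGroup.Build quotient_type quotient_mulA
  quotient_mul1g quotient_mulg1 quotient_mulVg quotient_mulgV.

HB.instance Definition _ := isMultiplicative.Build G quotient_type class
  (fun x y => esym (class_mul x y)).

Lemma quotient_projection : exists (H : groupType) (p : {multiplicative G -> H}),
  set_surj setT setT p /\ forall x, p x = 1 <-> N x.
Proof.
exists quotient_type, class; split; first by move=> x _; exists (repr x).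
move=> x; split=> [/esym/classP|Nx]; first by rewrite invg1 mul1g.
by apply/esym/classP; rewrite invg1 mul1g.
Qed.

End Quotient.
End GroupBasics.

(** * Finite index and finite generation *)

Section FiniteIndex.
Local Open Scope group_scope.
Implicit Types G H : groupType.

(** The list [s] meets every left coset of [A], possibly several times; no counting of cosets is
    involved. *)
Definition finite_index G (A : set G) : Prop :=
  exists s : seq G, forall x, exists2 t, t \in s & A (t^-1 * x).

Definition set_fg G (A : set G) : Prop :=
  exists2 s : seq G, (forall x, x \in s -> A x) &
    forall B : set G, is_subgroup B -> (forall x, x \in s -> B x) -> A `<=` B.

Lemma finite_indexS G (A B : set G) :
  A `<=` B -> finite_index A -> finite_index B.
Proof. by move=> AB [s sA]; exists s => x; have [t ts /AB] := sA x; exists t. Qed.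

Lemma finite_indexT G (A : set G) : A = setT -> finite_index A.
Proof. by move=> ->; exists [:: 1] => x; exists 1; rewrite ?inE. Qed.

Lemma finite_index_preimage G H (f : {multiplicative G -> H}) (A : set H) :
  set_surj setT setT f -> finite_index A -> finite_index (f @^-1` A).
Proof.
move=> fsurj [s sA].
have /choice[g gK] y : exists x, f x = y by have [x _ <-] := fsurj y I; exists x.
exists (map g s) => x; have [t ts At] := sA (f x).
by exists (g t); [exact: map_f|rewrite /= gmulfM multiplicativeV gK].
Qed.

Lemma finite_index_image G H (f : {multiplicative G -> H}) (A : set G) :
  set_surj setT setT f -> finite_index A -> finite_index (f @` A).
Proof.
move=> fsurj [s sA]; exists (map f s) => y; have [x _ <-] := fsurj y I.
have [t ts At] := sA x; exists (f t); first exact: map_f.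
by exists (t^-1 * x) => //; rewrite gmulfM multiplicativeV.
Qed.

Lemma finite_index_inj_image G H (f : {multiplicative G -> H}) (A : set G) :
  finite_index (range f) -> finite_index A -> finite_index (f @` A).
Proof.
move=> [s sf] [t tA]; exists [seq a * f b | a <- s, b <- t] => y.
have [a sa [x _ xE]] := sf y; have [b tb Ab] := tA x.
exists (a * f b); first by apply/allpairsP; exists (a, b).
by exists (b^-1 * x) => //; rewrite gmulfM multiplicativeV xE invgM !mulgA.
Qed.

Lemma finite_index_of_inj_image G H (f : {multiplicative G -> H}) (A : set G) :
  injective f -> finite_index (f @` A) -> finite_index A.
Proof.
move=> finj [s sf].
have /choice[g gK] y : exists x, (exists x', f x' = y) -> f x = y.
  by have [[x xy]|] := pselect (exists x', f x' = y); [exists x|exists 1].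
exists (map g s) => x; have [t ts [a Aa aE]] := sf (f x).
exists (g t); first exact: map_f.
suff -> : (g t)^-1 * x = a by [].
apply: finj; rewrite gmulfM multiplicativeV gK ?aE //.
(* [t] lies in the range of [f] because [t^-1 * f x = f a]. *)
by exists (x * a^-1); rewrite gmulfM multiplicativeV aE invgM invgK mulgA mulgV mul1g.
Qed.

(** A coset of [A] and a coset of [B] that meet do so in a coset of the intersection, so one common
    point for each such pair gives representatives. *)
Lemma finite_indexI G (A B : set G) : is_subgroup A -> is_subgroup B ->
  finite_index A -> finite_index B -> finite_index (A `&` B).
Proof.
move=> sA sB [s sAi] [t tBi].
have /choice[g gP] (p : G * G) : exists x,
    (exists x', A (p.1^-1 * x') /\ B (p.2^-1 * x')) ->
    A (p.1^-1 * x) /\ B (p.2^-1 * x).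
  by case: (pselect (exists x', A (p.1^-1 * x') /\ B (p.2^-1 * x')))
    => [[x xP]|]; [exists x|exists 1].
exists [seq g (a, b) | a <- s, b <- t] => x.
have [a sa Aa] := sAi x; have [b tb Bb] := tBi x.
have [|/= Ag Bg] := gP (a, b); first by exists x.
exists (g (a, b)); first by apply/allpairsP; exists (a, b).
split.
- rewrite -[g _](mulKg a^-1) invgK invgM -mulgA.
  exact: mul_subgroup sA (subgroupV sA Ag) Aa.
- rewrite -[g _](mulKg b^-1) invgK invgM -mulgA.
  exact: mul_subgroup sB (subgroupV sB Bg) Bb.
Qed.

Definition core G (A : set G) : set G := [set x | forall y, A (y^-1 * x * y)].

Lemma core_sub G (A : set G) : core A `<=` A.
Proof. by move=> x /(_ 1); rewrite invg1 mul1g mulg1. Qed.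

Lemma core_normal G (A : set G) : is_subgroup A -> normal_subgroup (core A).
Proof.
move=> sA; split; [split=> [z|x y Ax Ay z]|move=> x y Ax z].
- by rewrite mulg1 mulVg; exact: sA.1.
- have -> : z^-1 * (x * y^-1) * z = (z^-1 * x * z) * (z^-1 * y * z)^-1.
    by rewrite !invgM invgK !mulgA mulgK.
  exact: sA.2.
- by have := Ax (y * z); rewrite invgM !mulgA.
Qed.

(** The core is the intersection of the conjugates of [A], and a conjugate depends only on the coset
    of the conjugating element: finitely many subgroups of finite index are intersected. *)
Lemma finite_index_core G (A : set G) :
  is_subgroup A -> finite_index A -> finite_index (core A).
Proof.
move=> sA iA; have [s sAi] := iA.
pose conj t : set G := [set x | A (t^-1 * x * t)].
have sconj t : is_subgroup (conj t).
  split=> [|x y Ax Ay]; first by rewrite /conj /= mulg1 mulVg; exact: sA.1.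
  rewrite /conj /=; have -> : t^-1 * (x * y^-1) * t = (t^-1 * x * t) * (t^-1 * y * t)^-1.
    by rewrite !invgM invgK !mulgA mulgK.
  exact: sA.2.
have iconj t : finite_index (conj t).
  exists [seq t * a * t^-1 | a <- s] => x.
  have [a sa Aa] := sAi (t^-1 * x * t).
  exists (t * a * t^-1); first exact: map_f.
  by rewrite /conj /= !invgM invgK !mulgA mulVg mul1g -!mulgA in Aa *.
have [B [sB iB BP]] : exists B : set G, [/\ is_subgroup B, finite_index B &
    forall x t, B x -> t \in s -> conj t x].
  elim: s {sAi} => [|t s [B [sB iB BP]]].
    by exists setT; split=> //; exact: finite_indexT.
  exists (conj t `&` B); split.
  - split=> [|x y [xt xB] [yt yB]]; first by split; [exact: (sconj t).1|exact: sB.1].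
    by split; [exact: (sconj t).2|exact: sB.2].
  - exact: finite_indexI.
  - by move=> x t' [tx Bx]; rewrite inE => /predU1P[->//|]; exact: BP.
apply: finite_indexS iB => x Bx y; have [t ts At] := sAi y.
have -> : y^-1 * x * y = (t^-1 * y)^-1 * (t^-1 * x * t) * (t^-1 * y).
  by rewrite invgM invgK -!mulgA mulVKg !mulgA mulgK.
by apply: mul_subgroup sA (mul_subgroup sA (subgroupV sA At) _) At; exact: BP.
Qed.

Lemma set_fg_image G H (f : {multiplicative G -> H}) (A : set G) :
  set_fg A -> set_fg (f @` A).
Proof.
move=> [s sA Amin]; exists (map f s).
  by move=> _ /mapP[x xs ->]; exists x => //; exact: sA.
move=> B sB sfB _ [x Ax <-]; apply: (Amin (f @^-1` B) _ _ x Ax).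
  exact: is_subgroup_preimage.
by move=> z zs; apply: sfB; exact: map_f.
Qed.

Lemma set_fg_of_inj_image G H (f : {multiplicative G -> H}) (A : set G) :
  injective f -> set_fg (f @` A) -> set_fg A.
Proof.
move=> finj [s sA Amin].
have /choice[g gP] y : exists x, (f @` A) y -> A x /\ f x = y.
  by case: (pselect ((f @` A) y)) => [[x Ax xy]|]; [exists x|exists 1].
exists (map g s); first by move=> _ /mapP[y ys ->]; exact: (gP y (sA y ys)).1.
move=> B sB sfB x Ax; suff [y By /finj <-] : (f @` B) (f x) by [].
apply: (Amin (f @` B)); [exact: is_subgroup_image| |by exists x].
move=> y ys; exists (g y); first by apply: sfB; exact: map_f.
exact: (gP y (sA y ys)).2.
Qed.

(* Schreier's lemma: the generators are the elements [t'^-1 * a * t] of [M] with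
   [t], [t'] coset representatives and [a] a generator, and the representatives
   in [M]; the cosets [t * B] of the group [B] they generate are permuted by
   left multiplication by [a], so they cover everything. *)
Lemma set_fg_finite_index G (M : set G) : is_subgroup M -> finite_index M ->
  set_fg [set: G] -> set_fg M.
Proof.
move=> sM [s sMi] [g _ gT].
pose a := g ++ [seq x^-1 | x <- g].
pose l := [seq x <- [seq t'^-1 * x | t' <- s, x <- [seq u * t | u <- a, t <- s]] ++ s
             | `[< M x >]].
exists l => [x|B0 sB0 lB0 m Mm]; first by rewrite mem_filter => /andP[/asboolP].
pose B := B0 `&` M.
have sB : is_subgroup B.
  split=> [|x y [xB xM] [yB yM]]; first by split; [exact: sB0.1|exact: sM.1].
  by split; [exact: sB0.2|exact: sM.2].
have lB x : x \in l -> B x.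
  by move=> xl; split; [exact: lB0|move: xl; rewrite mem_filter => /andP[/asboolP]].
pose U := [set x | exists2 t, t \in s & B (t^-1 * x)].
have aU u x : u \in a -> U x -> U (u * x).
  move=> ua [t ts Bt]; have [t' ts' Mt'] := sMi (u * t).
  exists t' => //.
  have -> : t'^-1 * (u * x) = (t'^-1 * (u * t)) * (t^-1 * x).
    by rewrite -!mulgA mulVKg.
  apply: (mul_subgroup sB _ Bt); apply: lB.
  rewrite mem_filter (asboolT Mt') mem_cat; apply/orP; left.
  apply/allpairsP; exists (t', u * t); split=> //=.
  by apply/allpairsP; exists (u, t).
have Bs x : M x -> x \in s -> B x.
  by move=> Mx xs; apply: lB; rewrite mem_filter (asboolT Mx) mem_cat xs orbT.
have [t ts Bt] : U m.
  suff [/(_ 1)] : [set x | (forall y, U y -> U (x * y)) /\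
                           (forall y, U y -> U (x^-1 * y))] m.
    rewrite mulg1 => Um _; apply: Um; have [t ts Mt] := sMi 1.
    exists t => //; rewrite mulg1 in Mt *; apply: subgroupV => //; apply: Bs => //.
    by rewrite -[t]invgK; exact: subgroupV.
  apply: (gT [set x | _]) => //; first split.
  - by split=> y; rewrite ?invg1 mul1g.
  - move=> x y [xU xVU] [yU yVU]; split=> z Uz; rewrite ?invgM ?invgK -mulgA.
    + exact/xU/yVU.
    + exact/yU/xVU.
  - move=> x xg; split=> y; apply: aU; rewrite mem_cat ?xg //.
    by apply/orP; right; exact: map_f.
have Mt : M t.
  have -> : t = m * (t^-1 * m)^-1 by rewrite invgM invgK mulgA mulgV mul1g.
  exact: sM.2 Mm Bt.2.
rewrite -[m](mulVKg t); exact: (mul_subgroup sB (Bs _ Mt ts) Bt).1.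
Qed.

End FiniteIndex.

(** * Virtually abelian quotients of elementary amenable groups *)

Section ElementaryAmenable.
Local Open Scope group_scope.
Implicit Types D G H K M N Q : groupType.

(** Expresses that [K] has infinite abelianization without forming its commutator subgroup: any
    subgroup [L] of infinite index containing the commutators of [K] will do. *)
Definition infinite_virtual_abelianization Q : Prop :=
  exists K L : set Q, [/\ is_subgroup K, is_subgroup L, finite_index K,
    ~ finite_index L & forall x y, K x -> K y -> L [~ x, y]].

Lemma infinite_virtual_abelianization_quotient Q D (p : {multiplicative Q -> D}) :
  set_surj setT setT p ->
  infinite_virtual_abelianization D -> infinite_virtual_abelianization Q.
Proof.
move=> psurj [K [L [sK sL iK iL KL]]]; exists (p @^-1` K), (p @^-1` L).
split; [exact: is_subgroup_preimage|exact: is_subgroup_preimage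
       |exact: finite_index_preimage| |].
  move=> /(finite_index_image psurj) iL'; apply: iL; apply: finite_indexS iL'.
  by move=> _ [x Lx <-].
by move=> x y Kx Ky; rewrite /= !gmulfM !multiplicativeV; exact: KL.
Qed.

Lemma infinite_virtual_abelianization_finite_index Q M
    (i : {multiplicative M -> Q}) :
  injective i -> finite_index (range i) ->
  infinite_virtual_abelianization M -> infinite_virtual_abelianization Q.
Proof.
move=> iinj fi [K [L [sK sL iK iL KL]]]; exists (i @` K), (i @` L).
split; [exact: is_subgroup_image|exact: is_subgroup_image
       |exact: finite_index_inj_image| |].
  by move=> /(finite_index_of_inj_image iinj).
move=> _ _ [x Kx <-] [y Ky <-]; exists [~ x, y]; first exact: KL.
by rewrite !gmulfM !multiplicativeV.
Qed.

(* [Q] is the quotient of the subgroup [{x | exists y, r x y}] of [G] by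
   [{x | r x 1}]. *)
Definition subquotient G Q (r : G -> Q -> Prop) : Prop :=
  [/\ r 1 1,
      forall x y x' y', r x y -> r x' y' -> r (x * x'^-1) (y * y'^-1),
      forall y, exists x, r x y &
      forall y, r 1 y -> y = 1].

(** The induction hypothesis. For subgroups and quotients of [G] it is inherited by composing
    relations. *)
Definition subquotients_virtually_abelianizable G : Prop :=
  forall Q (r : G -> Q -> Prop), subquotient r -> set_fg [set: Q] ->
    ~ finite_index [set (1 : Q)] -> infinite_virtual_abelianization Q.

Lemma subquotient_fun G Q (r : G -> Q -> Prop) x y y' :
  subquotient r -> r x y -> r x y' -> y = y'.
Proof.
move=> [_ rM _ r1] rxy rxy'; apply/divg1_eq/r1.
by rewrite -(mulgV x); exact: rM.
Qed.

Lemma subquotientV G Q (r : G -> Q -> Prop) x y :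
  subquotient r -> r x y -> r x^-1 y^-1.
Proof. by move=> [r11 rM _ _] rxy; rewrite -[x^-1]mul1g -[y^-1]mul1g; exact: rM. Qed.

Lemma subquotientM G Q (r : G -> Q -> Prop) x y x' y' :
  subquotient r -> r x y -> r x' y' -> r (x * x') (y * y').
Proof.
move=> sr rxy rxy'; rewrite -[x']invgK -[y']invgK.
by have [_ rM _ _] := sr; apply: rM => //; exact: subquotientV.
Qed.

Lemma finite_index1 G : finite_index [set (1 : G)] <-> finite_set [set: G].
Proof.
split=> [[s sG]|/finite_seqP[s sG]].
  apply/finite_seqP; exists s; apply/seteqP; split=> // x _.
  by have [t ts /(canRL (mulKg _))] := sG x; rewrite invgK mulg1 /= => ->.
exists s => x; exists x; last by rewrite /= mulVg.
by have : [set: G] x by []; rewrite sG.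
Qed.

Lemma finite_subquotient G Q (r : G -> Q -> Prop) : subquotient r ->
  finite_index [set (1 : G)] -> finite_index [set (1 : Q)].
Proof.
move=> sr /finite_index1/finite_seqP[s sG].
have /choice[g gP] x : exists y, (exists y', r x y') -> r x y.
  by case: (pselect (exists y', r x y')) => [[y rxy]|]; [exists y|exists 1].
exists (map g s) => y; have [_ _ /(_ y)[x rxy] _] := sr.
have -> : y = g x by apply: (subquotient_fun sr rxy); apply: gP; exists y.
exists (g x); last by rewrite /= mulVg.
by apply: map_f; have : [set: G] x by []; rewrite sG.
Qed.

Lemma subquotients_virtually_abelianizable_extension N G Q
    (f : {multiplicative N -> G}) (p : {multiplicative G -> Q}) :
  set_surj setT setT p -> range f = p @^-1` [set 1] ->
  subquotients_virtually_abelianizable N ->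
  subquotients_virtually_abelianizable Q ->
  subquotients_virtually_abelianizable G.
Proof.
move=> psurj fp PN PQ E r sr fgE infE.
have [r11 rM rsurj rfun] := sr.
have pf n : p (f n) = 1.
  by have : range f (f n) by [exists n]; rewrite fp.
have kerp x : p x = 1 -> exists n, f n = x.
  move=> px; have : (p @^-1` [set 1]) x by [].
  by rewrite -fp => -[n _ <-]; exists n.
(* The image in [E] of the kernel of [p]: it is a subquotient of [N], while the quotient of [E] by
   it is a subquotient of [Q]. *)
pose M := [set y | exists n, r (f n) y].
have nM : normal_subgroup M.
  split; [split=> [|x y [n rx] [m ry]]|move=> y z [n ry]].
  - by exists 1; rewrite multiplicative1.
  - by exists (n * m^-1); rewrite gmulfM multiplicativeV; exact: rM.
  - have [x rx] := rsurj z.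
    have [m fm] : exists m, f m = x^-1 * f n * x.
      by apply: kerp; rewrite !gmulfM pf mulg1 -gmulfM mulVg multiplicative1.
    exists m; rewrite fm; apply: subquotientM => //.
    by apply: subquotientM => //; exact: subquotientV.
have [D [q [qsurj qker]]] := quotient_projection nM.
have [iM|iM] := pselect (finite_index M).
- have [M' [i [iinj iran]]] := subgroup_inclusion nM.1.
  apply: (infinite_virtual_abelianization_finite_index iinj).
    by rewrite iran.
  apply: (PN M' (fun n m => r (f n) (i m))).
  - split=> [|n y n' y' rn rn'|y|y].
    + by rewrite !multiplicative1.
    + by rewrite !gmulfM !multiplicativeV; exact: rM.
    + by have : range i (i y) by []; rewrite iran.
    + by rewrite !multiplicative1 => /rfun; rewrite -(multiplicative1 i) => /iinj.
  - apply: (set_fg_of_inj_image iinj); rewrite iran.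
    exact: set_fg_finite_index nM.1 iM fgE.
  - move=> fi; apply: infE.
    have : finite_index (i @` [set 1]) by apply: finite_index_inj_image; rewrite ?iran.
    by apply: finite_indexS => _ [_ -> <-]; rewrite multiplicative1.
- apply: (infinite_virtual_abelianization_quotient qsurj).
  apply: (PQ D (fun z d => exists x y, [/\ p x = z, r x y & q y = d])).
  - split.
    + by exists 1, 1; rewrite !multiplicative1.
    + move=> _ _ _ _ [x [y [<- rxy <-]]] [x' [y' [<- rxy' <-]]].
      exists (x * x'^-1), (y * y'^-1).
      by rewrite !gmulfM !multiplicativeV; split=> //; exact: rM.
    + move=> d; have [y _ <-] := qsurj d I; have [x rxy] := rsurj y.
      by exists (p x), x, y.
    + move=> _ [x [y [/kerp[n nx] rxy <-]]]; apply/qker.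
      by exists n; rewrite nx.
  - have -> : [set: D] = q @` setT.
      by apply/seteqP; split=> // d _; have [y _ <-] := qsurj d I; exists y.
    exact: set_fg_image.
  - move=> /(finite_index_preimage qsurj) fi; apply: iM.
    by apply: finite_indexS fi => y /qker.
Qed.

Lemma multiplicative_factor_inj G H K (j : {multiplicative H -> K})
    (g : {multiplicative G -> K}) :
  injective j -> range g `<=` range j ->
  exists h : {multiplicative G -> H}, forall x, j (h x) = g x.
Proof.
move=> jinj gj.
have /choice[h hP] x : exists y, j y = g x.
  by have [|y _ yE] := gj (g x); [exists x|exists y].
have hM : {morph h : x y / x * y}.
  by move=> x y; apply: jinj; rewrite gmulfM !hP gmulfM.
pose hmul := isMultiplicative.Build G H h hM.
by exists (HB.pack_for {multiplicative G -> H} h hmul).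
Qed.

Lemma directed_seq (I : Type) (le : I -> I -> Prop) (T : eqType)
    (P : I -> T -> Prop) (s : seq T) :
  directed_preorder le -> (forall i j x, le i j -> P i x -> P j x) ->
  (forall x, x \in s -> exists i, P i x) ->
  exists i, forall x, x \in s -> P i x.
Proof.
move=> [[i0] _ _ le2] Ple; elim: s => [|a s IH] sP; first by exists i0.
have [|i iP] := IH; first by move=> x xs; apply: sP; rewrite inE xs orbT.
have [j ja] := sP a (mem_head _ _).
have [k ik jk] := le2 i j; exists k => x; rewrite inE => /predU1P[->|xs].
  exact: Ple ja.
by apply: Ple (iP _ xs).
Qed.

(** By directedness the elements coming from some [A i] form a subgroup. The cocone factors through
    it, so the universal map into it followed by inclusion agrees with the identity on all
    [psi i x]; by uniqueness it is the identity of [G]. *)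
Lemma direct_limit_cover (I : Type) (le : I -> I -> Prop) (A : I -> groupType)
    (phi : forall i j, le i j -> {multiplicative A i -> A j})
    (G : groupType) (psi : forall i, {multiplicative A i -> G}) :
  direct_system phi -> direct_limit phi psi ->
  forall g, exists i a, psi i a = g.
Proof.
move=> [[[i0] lexx letr le2] phi1 phiM] [psic univ].
pose U := [set g | exists i a, psi i a = g].
have sU : is_subgroup U.
  split=> [|_ _ [i [a <-]] [j [b <-]]]; first by exists i0, 1; rewrite multiplicative1.
  have [k ik jk] := le2 i j; exists k, (phi i k ik a * (phi j k jk b)^-1).
  by rewrite gmulfM multiplicativeV !psic.
have [H [j [jinj jU]]] := subgroup_inclusion sU.
have lift i : exists h : {multiplicative A i -> H}, forall x, j (h x) = psi i x.
  by apply: multiplicative_factor_inj => // _ [a _ <-]; rewrite jU; exists i, a.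
pose chi i := projT1 (cid (lift i)).
have chiE i x : j (chi i x) = psi i x by rewrite /chi; case: cid.
have chic : cocone phi chi.
  by move=> i k ik x; apply: jinj; rewrite !chiE psic.
have [[u uE] _] := univ H chi chic.
have [_ uniq] := univ G psi psic.
move=> g; suff : range j g by rewrite jU.
exists (u g) => //.
apply: (uniq (j \o u : {multiplicative G -> G}) (idfun : {multiplicative G -> G})).
  by move=> i x /=; rewrite uE.
by [].
Qed.

Lemma elementary_amenable_subquotients G :
  elementary_amenable G -> subquotients_virtually_abelianizable G.
Proof.
elim=> {G} [G finG|G abG|G H f finj _ PG|G Q p psurj _ PG
  |N G Q f p finj psurj fp _ PN _ PQ|I le A phi G psi dirA limG _ PA].
- move=> Q r sr _ []; apply: (finite_subquotient sr).
  exact/finite_index1.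
(* A subquotient of an abelian group is abelian, so [K] can be everything and [L] trivial. *)
- move=> Q r sr _ infQ; exists setT, [set 1]; split=> //.
  + by split=> // _ _ -> ->; rewrite mulgV.
  + exact: finite_indexT.
  + move=> x y _ _; apply/eqP/commgP.
    have [_ _ rsurj _] := sr; have [a ra] := rsurj x; have [b rb] := rsurj y.
    apply: (subquotient_fun sr (subquotientM sr ra rb)).
    by rewrite abG; exact: subquotientM.
- move=> Q r [r11 rM rsurj rfun].
  apply: (PG Q (fun g y => exists2 h, f h = g & r h y)); split.
  + by exists 1; rewrite ?multiplicative1.
  + move=> _ y _ y' [h <- rhy] [h' <- rhy']; exists (h * h'^-1).
      by rewrite gmulfM multiplicativeV.
    exact: rM.
  + by move=> y; have [h rhy] := rsurj y; exists (f h), h.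
  + by move=> y [h]; rewrite -(multiplicative1 f) => /finj ->; exact: rfun.
- move=> D r [r11 rM rsurj rfun]; apply: (PG D (fun g y => r (p g) y)); split.
  + by rewrite multiplicative1.
  + by move=> x y x' y'; rewrite gmulfM multiplicativeV; exact: rM.
  + by move=> y; have [x rxy] := rsurj y; have [g _ gx] := psurj x I; exists g; rewrite gx.
  + by move=> y; rewrite multiplicative1; exact: rfun.
- exact: subquotients_virtually_abelianizable_extension fp PN PQ.
- move=> Q r sr fgQ; have [r11 rM rsurj rfun] := sr.
  have [s _ sgen] := fgQ.
  have [dirI _ _] := dirA.
  (* Finitely many generators of [Q] have representatives in a single [A i], so [Q] is a subquotient
     of that [A i]. *)
  have [|y ys|i iP] := @directed_seq I le Q (fun i y => exists a, r (psi i a) y) s dirI.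
  + by move=> i j y ij [a ra]; exists (phi i j ij a); rewrite limG.1.
  + have [x rx] := rsurj y; have [i [a ax]] := direct_limit_cover dirA limG x.
    by exists i, a; rewrite ax.
  apply: (PA i Q (fun a y => r (psi i a) y)) => //; split.
  + by rewrite multiplicative1.
  + by move=> x y x' y'; rewrite gmulfM multiplicativeV; exact: rM.
  + move=> y; apply: (sgen [set y | exists a, r (psi i a) y]) => //; split.
      by exists 1; rewrite multiplicative1.
    move=> x z [a rx] [b rz]; exists (a * b^-1).
    by rewrite gmulfM multiplicativeV; exact: rM.
  + by move=> y; rewrite multiplicative1; exact: rfun.
Qed.

End ElementaryAmenable.

(** * Finitely generated abelian subgroups *)

Section FreeAbelian.
Local Open Scope group_scope.
Import GRing.Theory.
Variable H : groupType.

Definition expgz (x : H) (z : int) : H :=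
  match z with Posz n => x ^+ n | Negz n => x ^- n.+1 end.

Lemma expgzD1 x z : expgz x (z + 1)%R = expgz x z * x.
Proof.
case: z => [n|[|n]]; first by rewrite /= addn1 expgSr.
  by rewrite /= mulVg.
have -> : (Negz n.+1 + 1)%R = Negz n by rewrite !NegzE -[n.+2]addn1 PoszD opprD addrNK.
by rewrite /= [x ^+ n.+2]expgS invgM mulgVK.
Qed.

Lemma expgzB1 x z : expgz x (z - 1)%R = expgz x z * x^-1.
Proof. by rewrite -[in RHS](subrK 1%R z) expgzD1 mulgK. Qed.

Lemma expgzD x y z : expgz x (y + z)%R = expgz x y * expgz x z.
Proof.
elim: z => [|n IH|n IH]; first by rewrite addr0 mulg1.
  by rewrite -[n.+1]addn1 PoszD addrA !expgzD1 IH mulgA.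
by rewrite -[n.+1]addn1 PoszD opprD addrA !expgzB1 IH mulgA.
Qed.

Variable N : set H.
Hypothesis sN : is_subgroup N.
Hypothesis abN : forall x y, N x -> N y -> x * y = y * x.

Lemma expgz_mem x z : N x -> N (expgz x z).
Proof.
by case: z => n Nx /=; [exact: subgroupX|apply: subgroupV => //; exact: subgroupX].
Qed.

Definition morph_onto d (phi : 'rV[int]_d -> H) : Prop :=
  (forall u v, phi (u + v)%R = phi u * phi v) /\ range phi = N.

Section MorphOnto.
Variables (d : nat) (phi : 'rV[int]_d -> H) (phiN : morph_onto phi).

Lemma morph_onto0 : phi 0%R = 1.
Proof. by apply: (@mulgI _ (phi 0%R)); rewrite -phiN.1 addr0 mulg1. Qed.

Lemma morph_ontoV u : phi (- u)%R = (phi u)^-1.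
Proof. by apply: (@mulgI _ (phi u)); rewrite -phiN.1 addrN mulgV morph_onto0. Qed.

Lemma morph_ontoX u n : phi (u *+ n)%R = phi u ^+ n.
Proof.
by elim: n => [|n IH]; rewrite ?morph_onto0 // mulrS phiN.1 IH expgS.
Qed.

Lemma morph_ontoZ u c : phi (c *: u)%R = expgz (phi u) c.
Proof.
have scale_nat n : (Posz n *: u = u *+ n)%R by rewrite -scaler_nat natz.
case: c => n; first by rewrite scale_nat morph_ontoX.
by rewrite NegzE scaleNr morph_ontoV scale_nat morph_ontoX.
Qed.

Lemma morph_onto_mem u : N (phi u).
Proof. by have : range phi (phi u) by [exists u]; rewrite phiN.2. Qed.

Lemma morph_onto_ex x : N x -> exists u, phi u = x.
Proof. by rewrite -phiN.2 => -[u _ <-]; exists u. Qed.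

End MorphOnto.

(** Each new generator [a] contributes one coordinate, sent to powers of [a]; commutativity of [N]
    keeps the map additive. *)
Lemma ex_morph_onto : set_fg N -> exists d (phi : 'rV[int]_d -> H), morph_onto phi.
Proof.
move=> [s sN' Nmin].
have [d [phi [phiD phiN phis]]] : exists d (phi : 'rV[int]_d -> H),
    [/\ forall u v, phi (u + v)%R = phi u * phi v, forall u, N (phi u) &
        forall x, x \in s -> range phi x].
  elim: s sN' {Nmin} => [_|a s IH sN'].
    by exists 0%N, (fun=> 1); split=> // [u v|u]; [rewrite mulg1|exact: sN.1].
  have Na : N a by apply: sN'; rewrite mem_head.
  have [|d [phi [phiD phiN phis]]] := IH.
    by move=> x xs; apply: sN'; rewrite inE xs orbT.
  exists (1 + d)%N, (fun u : 'rV_(1 + d) => expgz a (lsubmx u ord0 ord0) * phi (rsubmx u)).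
  split=> [u v|u|x].
  - rewrite !linearD /= mxE expgzD phiD !mulgA; congr (_ * _).
    by rewrite -!mulgA; congr (_ * _); apply: abN => //; exact: expgz_mem.
  - by apply: mul_subgroup sN (expgz_mem _ Na) (phiN _).
  - have phi0 : phi 0%R = 1 by apply: (@mulgI _ (phi 0%R)); rewrite -phiD addr0 mulg1.
    rewrite inE => /predU1P[->|/phis[u _ <-]].
      by exists (row_mx 1%:M 0)%R => //; rewrite row_mxKl row_mxKr phi0 mxE mulg1.
    by exists (row_mx 0 u)%R => //; rewrite row_mxKl row_mxKr mxE mul1g.
exists d, phi; split=> //; apply/seteqP; split=> [_ [u _ <-]//|].
have phi0 : phi 0%R = 1 by apply: (@mulgI _ (phi 0%R)); rewrite -phiD addr0 mulg1.
apply: Nmin => //; split=> [|_ _ [u _ <-] [v _ <-]]; first by exists 0%R.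
exists (u - v)%R => //; rewrite phiD; congr (_ * _).
by apply: (@mulgI _ (phi v)); rewrite -phiD addrN mulgV phi0.
Qed.

(** Finitely many commuting torsion generators have a common exponent [m.+1], which then kills all
    of [N]. Reducing coordinates modulo [m.+1] shows that finitely many vectors already map onto
    [N]. *)
Lemma finite_torsion_fg : set_fg N ->
  (forall x, N x -> exists n, x ^+ n.+1 = 1) -> finite_set N.
Proof.
move=> fgN tN; have [d [phi phiN]] := ex_morph_onto fgN.
have [m mP] : exists m, forall x, N x -> x ^+ m.+1 = 1.
  have [s sN' Nmin] := fgN.
  suff [m ms] : exists m, forall x, x \in s -> x ^+ m.+1 = 1.
    exists m => x Nx; suff [] : (N `&` [set x | x ^+ m.+1 = 1]) x by [].
    apply: (Nmin (_ `&` _)) Nx; last by move=> y ys; split; [exact: sN'|exact: ms].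
    split=> [|y z [Ny ym] [Nz zm]]; first by split; [exact: sN.1|exact: expg1n].
    split; first exact: sN.2.
    by rewrite /= expgnFl ?ym ?zm ?divgg //; exact: abN.
  elim: s sN' {Nmin} => [_|a s IH sN']; first by exists 0.
  have [|m mP] := IH; first by move=> x xs; apply: sN'; rewrite inE xs orbT.
  have [k ak] : exists k, a ^+ k.+1 = 1 by apply/tN/sN'; rewrite mem_head.
  exists (k.+1 * m.+1).-1 => x; rewrite prednK // inE => /predU1P[->|xs].
    by rewrite expgnA ak expg1n.
  by rewrite mulnC expgnA mP // expg1n.
pose res (i : 'I_m.+1) : int := Posz i.
have : finite_set (range (fun u : 'rV['I_m.+1]_d => phi (map_mx res u))).
  exact/finite_image/finite_finset.
apply: sub_finite_set => x Nx; have [u <-] := morph_onto_ex phiN Nx.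
pose v : 'rV['I_m.+1]_d := map_mx (fun z => inord `|(z %% m.+1)%Z|%N) u.
exists v => //.
pose q : 'rV[int]_d := map_mx (fun z => (z %/ m.+1)%Z) u.
suff -> : u = (map_mx res v + q *+ m.+1)%R.
  by rewrite phiN.1 morph_ontoX // mP ?mulg1 //; exact: morph_onto_mem.
apply/rowP => j; rewrite !mxE mulmxnE !mxE /res inordK; last first.
  by rewrite -ltz_nat gez0_abs ?modz_ge0 // ltz_pmod.
rewrite gez0_abs ?modz_ge0 // addrC pmulrn -mulrzr.
by rewrite [in LHS](divz_eq (u ord0 j) m.+1) intz.
Qed.

(* Among the surjections [Z^d -> N] one with [d] minimal is injective: putting
   a nonzero kernel vector into Smith normal form, a primitive vector of [Z^d]
   is killed since [N] is torsion free, and it can be split off. *)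
Lemma torsion_free_isomorphic_to_Zn : set_fg N ->
  (forall x n, N x -> x ^+ n.+1 = 1 -> x = 1) -> exists d, isomorphic_to_Zn d N.
Proof.
move=> fgN tfN.
pose P d := `[< exists phi : 'rV[int]_d -> H, morph_onto phi >].
have exP : exists d, P d.
  by have [d dP] := ex_morph_onto fgN; exists d; apply/asboolP.
have [d /asboolP[phi phiN] dmin] := ex_minnP exP.
exists d, phi; have [phiD phiR] := phiN; split=> //.
suff ker u : phi u = 1 -> u = 0%R.
  move=> u v uv; apply/eqP; rewrite -subr_eq0; apply/eqP/ker.
  by rewrite phiD (morph_ontoV phiN) uv mulgV.
move=> phiu; case: (eqVneq u 0%R) => // u0; exfalso.
(* Here [L] is a 1 by 1 unit, so in the basis given by [M] the vector [u] is, up to sign, a multiple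
   of the first basis vector. *)
have [L Lu [M Mu [s _ uE]]] := int_Smith_normal_form u.
case: d phi phiN dmin phiD phiR u phiu u0 M Mu uE
  => [|d] phi phiN dmin phiD phiR u phiu u0 M Mu uE.
  by rewrite thinmx0 eqxx in u0.
pose psi (v : 'rV_d.+1) := phi (v *m M)%R.
have psiN : morph_onto psi.
  split=> [v w|]; first by rewrite /psi mulmxDl phiD.
  apply/seteqP; split=> [_ [v _ <-]|x Nx]; first exact: (morph_onto_mem phiN).
  have [w <-] := morph_onto_ex phiN Nx.
  by exists (w *m invmx M)%R => //; rewrite /psi mulmxKV.
pose e : 'rV[int]_d.+1 := delta_mx ord0 ord0.
have su : (\matrix_(i, j) (s`_i *+ (i == j :> nat)) = s`_0 *: e :> 'rV[int]_d.+1)%R.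
  by apply/rowP => j; rewrite !mxE !ord1 /= mulr_natr eq_sym.
have Le : psi (s`_0 *: e)%R = 1.
  have -> : (s`_0 *: e = invmx L *m (L *m (s`_0 *: e)))%R by rewrite mulKmx.
  rewrite -su /psi -mulmxA -uE.
  rewrite [invmx L]mx11_scalar mul_scalar_mx (morph_ontoZ phiN) phiu.
  by case: (_ ord0 ord0) => n /=; rewrite expg1n ?invg1.
have s0 : (s`_0 != 0)%R.
  apply: contra u0 => /eqP s0; by rewrite uE su s0 scale0r mulmx0 mul0mx.
(* A nonzero multiple of [e] is killed by [psi], and [N] is torsion free. *)
have psie : psi e = 1.
  move: Le s0; rewrite (morph_ontoZ psiN); case: (s`_0)%R => [[//|n]|n] /=.
    by move=> /(tfN _ _ (morph_onto_mem psiN e)).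
  by move=> /(canRL invgK); rewrite invg1 => /(tfN _ _ (morph_onto_mem psiN e)).
(* With [e] killed, the other [d] coordinates still map onto [N], against the minimality of
   [d.+1]. *)
suff : P d by move=> /dmin; rewrite ltnn.
pose inc (v : 'rV[int]_d) : 'rV[int]_(1 + d) := row_mx 0%R v.
have incD v w : inc (v + w)%R = (inc v + inc w)%R by rewrite /inc add_row_mx addr0.
have vE (v : 'rV[int]_(1 + d)) : v = (v ord0 ord0 *: (e : 'rV_(1 + d)) + inc (rsubmx v))%R.
  apply/rowP => j; rewrite !mxE eqxx; case: splitP => k jk; rewrite !mxE.
    by rewrite [j in RHS](_ : j = ord0) ?mulr1 ?addr0; [congr (v _ _)|];
      apply: val_inj; rewrite /= jk ord1.
  have -> : (j == ord0) = false by apply/eqP => /(congr1 val); rewrite /= jk.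
  by rewrite mulr0 add0r; congr (v _ _); apply: val_inj.
apply/asboolP; exists (psi \o inc); split.
  by move=> v w; rewrite /= -psiN.1; congr (psi _); exact: incD.
apply/seteqP; split=> [_ [v _ <-]|x Nx]; first exact: (morph_onto_mem psiN).
have [v <-] := morph_onto_ex psiN Nx; exists (rsubmx (v : 'rV_(1 + d))) => //.
by rewrite [in RHS](vE v) psiN.1 (morph_ontoZ psiN) psie; case: (v _ _) => n /=;
  rewrite expg1n ?invg1 mul1g.
Qed.

End FreeAbelian.

(** * The virtually free abelian quotient and its index *)

Section VirtuallyAbelianQuotient.
Local Open Scope group_scope.
Implicit Types G H : groupType.

Lemma finite_index1_of_finite G (A : set G) :
  finite_index A -> finite_set A -> finite_index [set (1 : G)].
Proof.
move=> [s sA] /finite_seqP[t tA]; exists [seq a * b | a <- s, b <- t] => x.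
have [a sa Aa] := sA x; exists x; last by rewrite /= mulVg.
apply/allpairsP; exists (a, a^-1 * x); split=> //=; last by rewrite mulVKg.
by move: Aa; rewrite tA.
Qed.

Lemma torsion_normal G (A : set G) : normal_subgroup A ->
  (forall x y, A x -> A y -> x * y = y * x) ->
  normal_subgroup [set x | A x /\ exists n, x ^+ n.+1 = 1].
Proof.
move=> [sA nA] abA; split; [split|].
- by split; [exact: sA.1|exists 0%N].
- move=> x y [Ax [n xn]] [Ay [m ym]]; split; first exact: sA.2.
  exists (n.+1 * m.+1).-1; rewrite prednK // expgnFl; last exact: abA.
  by rewrite expgnA xn mulnC expgnA ym !expg1n divgg.
- move=> x y [Ax [n xn]]; split; first exact: nA.
  by exists n; rewrite -mulgA -conjgE -conjXg xn conj1g.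
Qed.

Lemma virtually_free_abelian_quotient G : set_fg [set: G] ->
  infinite_virtual_abelianization G ->
  exists (H : groupType) (f : {multiplicative G -> H}) (N : set H) (d : nat),
    [/\ set_surj setT setT f, normal_subgroup N, finite_index N, (0 < d)%N &
        isomorphic_to_Zn d N].
Proof.
move=> fgG [K [L [sK sL iK iL KL]]].
have nK := core_normal sK; have nL := core_normal sL.
have iK0 := finite_index_core sK iK.
have iL0 : ~ finite_index (core L) by move/(finite_indexS (@core_sub _ L)).
(* A conjugate of a commutator is the commutator of the conjugates, and these lie in [K] by
   definition of its core. Hence [core K] becomes abelian modulo [core L]. *)
have comm x y : core K x -> core K y -> core L [~ x, y].
  move=> Kx Ky z; rewrite -mulgA -conjgE conjRg !conjgE !mulgA.
  by have := KL _ _ (Kx z) (Ky z); rewrite /commg /conjg !mulgA.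
have [H1 [q [qsurj qker]]] := quotient_projection nL.
pose A := q @` core K.
have nA : normal_subgroup A by exact: normal_subgroup_image.
have iA : finite_index A by exact: finite_index_image.
have abA x y : A x -> A y -> x * y = y * x.
  move=> [a Ka <-] [b Kb <-]; apply/commgP/eqP.
  rewrite /commg /conjg -!multiplicativeV -!gmulfM.
  by apply/qker; exact: comm.
have fgH1 : set_fg [set: H1].
  have -> : [set: H1] = q @` setT by apply/seteqP; split=> // x _; exact: qsurj.
  exact: set_fg_image.
have fgA : set_fg A by exact: set_fg_finite_index nA.1 iA fgH1.
have [H [p [psurj pker]]] := quotient_projection (torsion_normal nA abA).
pose N := p @` A.
have nN : normal_subgroup N by exact: normal_subgroup_image.
have [d dN] : exists d, isomorphic_to_Zn d N.
  apply: torsion_free_isomorphic_to_Zn nN.1 _ (set_fg_image p fgA) _.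
  - by move=> _ _ [a Aa <-] [b Ab <-]; rewrite -!gmulfM abA.
  - move=> _ n [a Aa <-]; rewrite -multiplicativeX => /pker[_ [m am]].
    apply/pker; split=> //; exists (n.+1 * m.+1).-1.
    by rewrite prednK // expgnA.
exists H, (p \o q : {multiplicative G -> H}), N, d; split=> //.
- by move=> z _; have [y _ <-] := psurj z I; have [x _ <-] := qsurj y I; exists x.
- exact: finite_index_image.
(* If [d = 0] then [N] is trivial, so [A] is torsion and, being finitely generated abelian, finite;
   then [H1] is finite and [core L] has finite index. *)
- rewrite lt0n; apply/eqP => d0; move: dN; rewrite d0 => -[phi [phiD phiinj phiN]].
  apply: iL0.
  suff /(finite_index_preimage qsurj) : finite_index [set (1 : H1)].
    by apply: finite_indexS => x /qker.
  apply: finite_index1_of_finite iA _; apply: finite_torsion_fg nA.1 abA fgA _.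
  move=> x Ax; have [] : A x /\ exists n, x ^+ n.+1 = 1 => //.
  apply/pker; have : N (p x) by exists x.
  have phi0 : phi 0%R = 1.
    by apply: (@mulgI _ (phi 0%R)); rewrite -phiD GRing.addr0 mulg1.
  by rewrite -phiN => -[u _ <-]; rewrite (thinmx0 u).
Qed.

Lemma finitely_generated_set_fg G : finitely_generated G -> set_fg [set: G].
Proof.
move=> [n [g gG]]; exists (codom g) => // B sB gB; rewrite -gG.
by apply: smallest_sub => // _ [k _ <-]; apply: gB; exact: codom_f.
Qed.

Lemma finite_index_has_index G (A : set G) : is_subgroup A ->
  finite_index A -> exists2 i, (0 < i)%N & has_index A i.
Proof.
move=> sA [s sAi].
have [i iA] : finite_set (left_cosets A).
  have : finite_set ((fun t => [set t * a | a in A]) @` [set` s]).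
    by apply: finite_image; exact: finite_seq.
  apply: sub_finite_set => _ [x _ <-]; have [t ts At] := sAi x.
  exists t => //; apply/seteqP; split=> _ [a Aa <-].
    exists ((t^-1 * x)^-1 * a); last by rewrite invgM invgK !mulgA mulgV mul1g.
    exact: mul_subgroup sA (subgroupV sA At) Aa.
  exists (t^-1 * x * a); last by rewrite !mulgA mulgV mul1g.
  exact: mul_subgroup.
exists i => //; rewrite lt0n; apply/eqP => i0; move: iA.
rewrite i0 II0 card_eq0 => /eqP c0.
have : left_cosets A [set 1 * a | a in A] by exists 1.
by rewrite c0.
Qed.

(** Labelling the cosets by ['I_i] lets the later pigeonhole arguments take place in a finite
    type. *)
Lemma has_index_code G (A : set G) i : is_subgroup A -> has_index A i ->
  exists c : G -> 'I_i, forall x y, c x = c y <-> A (x^-1 * y).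
Proof.
move=> sA /card_set_bijP[f [fI finj _]].
pose coset x := [set x * a | a in A].
have cosetP x : left_cosets A (coset x) by exists x.
have fi x : (f (coset x) < i)%N by exact: fI.
exists (fun x => Ordinal (fi x)) => x y; split=> [/(congr1 val)/=|Axy].
  move=> /finj; rewrite !inE => /(_ (cosetP _) (cosetP _)) E.
  have : coset y y by exists 1; [exact: sA.1|rewrite mulg1].
  by rewrite -E => -[a Aa <-]; rewrite mulKg.
apply: val_inj => /=; congr f; apply/seteqP; split=> _ [a Aa <-].
  exists ((x^-1 * y)^-1 * a); last by rewrite invgM invgK !mulgA mulgV mul1g.
  exact: mul_subgroup sA (subgroupV sA Axy) Aa.
exists (x^-1 * y * a); last by rewrite !mulgA mulgV mul1g.
exact: mul_subgroup.
Qed.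

End VirtuallyAbelianQuotient.

(** * Edge expansion of Nielsen graphs *)

Section BoundaryBounded.
Local Open Scope group_scope.
Variables (G : groupType) (n : nat).
Local Notation tuples := {ffun 'I_n -> G}.

Lemma apply_move_inj (m : nielsen_move n) : injective (@apply_move G n m).
Proof.
move=> x y; case: m => [i j ij s|i j ij s|j] /ffunP xy; apply/ffunP => k.
- have := xy i; have := xy j; have := xy k; rewrite !ffunE eqxx (eq_sym j i) (negbTE ij).
  by case: eqP => // -> _ -> /mulIg.
- have := xy i; have := xy j; have := xy k; rewrite !ffunE eqxx (eq_sym j i) (negbTE ij).
  by case: eqP => // -> _ -> /mulgI.
- by have := xy k; rewrite !ffunE; case: eqP => // -> /invg_inj.
Qed.

(** Only edges with source in [S] are counted, one for each vertex and move, so this is a lower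
    bound for the edge boundary when [S] lies in one component. *)
Definition outgoing (S : {fset tuples}) : nat :=
  \sum_(m : nielsen_move n) #|` [fset x in S | apply_move m x \notin S]%fset|.

Definition count_in (S : {fset tuples}) (A : set tuples) : nat :=
  #|` [fset x in S | `[< A x >]]%fset|.

Definition boundary_bounded (A : set tuples) : Prop :=
  exists C : nat, forall S : {fset tuples}, (count_in S A <= C * outgoing S)%N.

Lemma count_inS S (A B : set tuples) :
  A `<=` B -> (count_in S A <= count_in S B)%N.
Proof.
move=> AB; apply/fsubset_leq_card/fsubsetP => x; rewrite !inE /= => /andP[-> /asboolP Ax].
exact/asboolP/AB.
Qed.

Lemma count_inU S (A B : set tuples) :
  (count_in S (A `|` B) <= count_in S A + count_in S B)%N.
Proof.
rewrite /count_in -[X in (_ <= X)%N](cardfsUI) (leq_trans _ (leq_addr _ _)) //.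
apply/fsubset_leq_card/fsubsetP => x; rewrite !inE /= => /andP[-> /asboolP[Ax|Bx]].
  by rewrite (asboolT Ax).
by rewrite (asboolT Bx) orbT.
Qed.

Lemma count_in_disjoint S (A B : set tuples) : (forall x, A x -> ~ B x) ->
  (count_in S A + count_in S B <= count_in S (A `|` B))%N.
Proof.
move=> AB; rewrite /count_in -cardfsUI.
rewrite (_ : (_ `&` _)%fset = fset0%fset) ?cardfs0 ?addn0; last first.
  apply/fsetP => x; rewrite !inE /=; apply/negbTE/negP.
  by move=> /andP[/andP[_ /asboolP /AB Ax] /andP[_ /asboolP]].
apply/fsubset_leq_card/fsubsetP => x; rewrite !inE /=.
by move=> /orP[] /andP[-> /asboolP Ax]; apply/asboolP; [left|right].
Qed.

(** Moves are injective, so the points with image in [S] number at most [count_in S A]; the others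
    leave [S] under [m]. *)
Lemma count_in_move S (A : set tuples) m :
  (count_in S [set x | A (apply_move m x)] <= count_in S A + outgoing S)%N.
Proof.
pose B := [set x | A (apply_move m x) /\ apply_move m x \in S].
pose C := [set x | apply_move m x \notin S].
apply: leq_trans (_ : (count_in S B + count_in S C <= _)%N).
  apply: leq_trans (count_inU _ _ _); apply: count_inS => x Ax.
  by have [?|?] := boolP (apply_move m x \in S); [left|right].
apply: leq_add.
  rewrite /count_in; set F := [fset x in S | _]%fset.
  have <- : #|` (apply_move m @` F)%fset| = #|` F|.
    by rewrite card_imfset //; exact: apply_move_inj.
  apply/fsubset_leq_card/fsubsetP => _ /imfsetP[x xF ->]; move: xF.
  by rewrite !inE /= => /andP[_ /asboolP[Ax xS]]; rewrite xS asboolT.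
rewrite /outgoing (bigD1 m) //= (leq_trans _ (leq_addr _ _)) //.
apply/fsubset_leq_card/fsubsetP => x; rewrite !inE /= => /andP[->].
by move=> /asboolP.
Qed.

Lemma boundary_boundedS (A B : set tuples) :
  A `<=` B -> boundary_bounded B -> boundary_bounded A.
Proof.
by move=> AB [C CP]; exists C => S; exact: leq_trans (count_inS _ AB) (CP S).
Qed.

Lemma boundary_boundedU (A B : set tuples) :
  boundary_bounded A -> boundary_bounded B -> boundary_bounded (A `|` B).
Proof.
move=> [C CP] [D DP]; exists (C + D)%N => S; rewrite mulnDl.
by apply: leq_trans (count_inU _ _ _) _; exact: leq_add.
Qed.

Lemma boundary_bounded0 : boundary_bounded set0.
Proof.
exists 0%N => S; rewrite leqn0 cardfs_eq0; apply/eqP/fsetP => x; rewrite !inE /=.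
by apply/negbTE/negP => /andP[_ /asboolP].
Qed.

Lemma boundary_bounded_exists (T : finType) (A : T -> set tuples) :
  (forall t, boundary_bounded (A t)) -> boundary_bounded [set x | exists t, A t x].
Proof.
move=> AP; suff : boundary_bounded [set x | exists2 t, t \in enum T & A t x].
  by apply: boundary_boundedS => x [t At]; exists t; rewrite ?mem_enum.
elim: (enum T) => [|t s IH].
  by apply: boundary_boundedS boundary_bounded0 => x [].
apply: boundary_boundedS (boundary_boundedU (AP t) IH) => x [t'].
by rewrite inE => /predU1P[->|t's At]; [left|right; exists t'].
Qed.

Lemma boundary_bounded_move (A : set tuples) m :
  boundary_bounded A -> boundary_bounded [set x | A (apply_move m x)].
Proof.
move=> [C CP]; exists C.+1 => S; rewrite mulSn addnC.
by apply: leq_trans (count_in_move _ _ _) _; rewrite leq_add2r.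
Qed.

(** Up to points leaving [S], the two moves inject the part of [S] in [W] into disjoint pieces of
    itself. Its size [a] thus satisfies [2 a <= a + 2 b] with [b] the outgoing count, whence the
    constant 2. *)
Lemma boundary_bounded_paradoxical (W P : set tuples) m1 m2 :
  (forall x, W x -> W (apply_move m1 x) /\ P (apply_move m1 x)) ->
  (forall x, W x -> W (apply_move m2 x) /\ ~ P (apply_move m2 x)) ->
  boundary_bounded W.
Proof.
move=> W1 W2; exists 2%N => S; rewrite mul2n -addnn.
have le1 : (count_in S W <= count_in S (W `&` P) + outgoing S)%N.
  by apply: leq_trans (count_in_move _ _ m1); exact: count_inS.
have le2 : (count_in S W <= count_in S (W `\` P) + outgoing S)%N.
  by apply: leq_trans (count_in_move _ _ m2); exact: count_inS.
rewrite -(leq_add2l (count_in S W)); apply: leq_trans (leq_add le1 le2) _.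
rewrite addnACA leq_add2r; apply: leq_trans (count_in_disjoint _ _) _.
  by move=> x [_ Px] [].
by apply: count_inS => x [[]|[]].
Qed.

End BoundaryBounded.

(** * Words in the entries of a tuple *)

Section Words.
Local Open Scope group_scope.
Variable n : nat.
Local Notation letter := ('I_n * bool)%type.
Implicit Types (G H : groupType) (w : seq letter).

Definition eval_word G (h : 'I_n -> G) w : G :=
  foldr (fun l y => spow l.2 (h l.1) * y) 1 w.

Definition inv_word w : seq letter := [seq (l.1, ~~ l.2) | l <- rev w].

Lemma eval_word_cat G (h : 'I_n -> G) w w' :
  eval_word h (w ++ w') = eval_word h w * eval_word h w'.
Proof. by elim: w => [|l w IH] /=; rewrite ?mul1g // IH mulgA. Qed.

Lemma eval_inv_word G (h : 'I_n -> G) w :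
  eval_word h (inv_word w) = (eval_word h w)^-1.
Proof.
elim: w => [|l w IH]; first by rewrite /= invg1.
rewrite /inv_word rev_cons map_rcons -cats1 eval_word_cat IH /= invgM mulg1.
by case: l.2; rewrite //= invgK.
Qed.

Lemma size_inv_word w : size (inv_word w) = size w.
Proof. by rewrite size_map size_rev. Qed.

Lemma all_inv_word (P : pred 'I_n) w :
  all (fun l => P l.1) (inv_word w) = all (fun l => P l.1) w.
Proof. by rewrite all_map all_rev. Qed.

Lemma eval_word_morph G H (f : {multiplicative G -> H}) (h : 'I_n -> G) w :
  f (eval_word h w) = eval_word (f \o h) w.
Proof.
elim: w => [|l w IH] /=; first exact: multiplicative1.
by rewrite gmulfM IH; congr (_ * _); case: l.2; rewrite //= multiplicativeV.
Qed.

Lemma eq_in_eval_word G (h h' : 'I_n -> G) (P : pred 'I_n) w :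
  (forall k, P k -> h k = h' k) -> all (fun l => P l.1) w ->
  eval_word h w = eval_word h' w.
Proof. by move=> hh'; elim: w => //= l w IH /andP[/hh'-> /IH->]. Qed.

Lemma eval_word_filter G (h : 'I_n -> G) j w : h j = 1 ->
  eval_word h [seq l <- w | l.1 != j] = eval_word h w.
Proof.
move=> hj; elim: w => //= l w IH; case: eqP => [->|_] /=; rewrite IH //.
by rewrite hj; case: l.2; rewrite /= ?invg1 mul1g.
Qed.

Definition generates G (h : 'I_n -> G) : Prop :=
  forall B : set G, is_subgroup B -> (forall k, B (h k)) -> forall x, B x.

Lemma generatesP G (h : 'I_n -> G) : generates h -> forall y, exists w, eval_word h w = y.
Proof.
move=> hgen y; apply: (hgen [set y | exists w, eval_word h w = y]).
  split; first by exists [::].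
  move=> _ _ [w <-] [w' <-]; exists (w ++ inv_word w').
  by rewrite eval_word_cat eval_inv_word.
by move=> k; exists [:: (k, true)]; rewrite /= mulg1.
Qed.

(* Once a step from [k] to [k.+1] adds no [c]-value, no later step does, since
   [c] is compatible with left multiplication. *)
Lemma ball_growth G (h : 'I_n -> G) (P : pred letter) (T : eqType) (c : G -> T) k :
  (forall g x y, c x = c y -> c (g * x) = c (g * y)) ->
  (exists s : seq (seq letter),
    [/\ size s = k.+1, all (fun w => (size w <= k)%N && all P w) s &
        uniq [seq c (eval_word h w) | w <- s]]) \/
  (forall w, all P w ->
     exists w', [/\ (size w' <= k)%N, all P w' & c (eval_word h w') = c (eval_word h w)]).
Proof.
(* The empty word is kept in [s]: it starts the induction showing that a list which cannot grow
   reaches the values of all words. *)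
move=> cM; suff : (exists s : seq (seq letter),
    [/\ size s = k.+1, all (fun w => (size w <= k)%N && all P w) s,
      uniq [seq c (eval_word h w) | w <- s] & [::] \in s]) \/
  (forall w, all P w ->
     exists w', [/\ (size w' <= k)%N, all P w' & c (eval_word h w') = c (eval_word h w)]).
  by case=> [[s [sz sP us _]]|]; [left; exists s|right].
elim: k => [|k [[s [sz sP us s0]]|IH]]; first by left; exists [:: [::]].
- have [[w [l [ws Pl wl]]]|closed] := pselect (exists w l,
    [/\ w \in s, P l & c (eval_word h (l :: w)) \notin [seq c (eval_word h w) | w <- s]]).
    left; exists ((l :: w) :: s); split; [by rewrite /= sz| | |].
    + have /andP[szw Pw] := allP sP _ ws; rewrite /= ltnS szw Pl Pw /=.
      by apply: sub_all sP => v /andP[szv ->]; rewrite (leq_trans szv).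
    + by rewrite [map _ _]/= [uniq _]/= wl.
    + by rewrite inE s0 orbT.
  right=> w Pw; suff /mapP[v vs ->] : c (eval_word h w) \in [seq c (eval_word h w) | w <- s].
    by have /andP[szv Pv] := allP sP _ vs; exists v; rewrite (leq_trans szv).
  elim: w Pw => [_|l w IH /= /andP[Pl /IH/mapP[v vs vE]]]; first by apply/mapP; exists [::].
  apply/negPn/negP => nc; apply: closed; exists v, l; split=> //=.
  by rewrite -(cM _ _ _ vE).
- by right=> w /IH[v [szv Pv vE]]; exists v; rewrite leqW.
Qed.
End Words.

(** * Multiplying one entry by a word in the others *)

Section WordMoves.
Local Open Scope group_scope.
Variables (G : groupType) (n : nat).
Local Notation tuples := {ffun 'I_n -> G}.
Local Notation letter := ('I_n * bool)%type.

Definition multiply_by_word (x : tuples) (j : 'I_n) (w : seq letter) : tuples :=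
  [ffun k => if k == j then x j * eval_word x w else x k].

(** Letters other than [j] make the multiplication a composition of Nielsen moves, and the length
    bound leaves finitely many words. *)
Definition word_preimage (L : nat) (j : 'I_n) (A : set tuples) : set tuples :=
  [set x | exists w, [/\ (size w <= L)%N, all (fun l => l.1 != j) w &
                         A (multiply_by_word x j w)]].

Lemma multiply_by_word_nil x j : multiply_by_word x j [::] = x.
Proof. by apply/ffunP => k; rewrite ffunE /= mulg1; case: eqP => // ->. Qed.

(** The move changes only the entry [j], which [w] does not read. *)
Lemma multiply_by_word_cons x j l w (jl : j != l.1) : all (fun l => l.1 != j) w ->
  multiply_by_word x j (l :: w) = multiply_by_word (apply_move (move_R jl l.2) x) j w.
Proof.
move=> jw; have xE : eval_word (apply_move (move_R jl l.2) x) w = eval_word x w.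
  apply: (@eq_in_eval_word _ _ _ _ [pred k | k != j] _ _ jw) => k kj.
  by rewrite ffunE (negbTE kj).
by apply/ffunP => k; rewrite !ffunE; case: eqP => //= _; rewrite eqxx xE mulgA.
Qed.

Lemma generating_multiply_by_word x j w : all (fun l => l.1 != j) w ->
  generating_tuple x -> generating_tuple (multiply_by_word x j w).
Proof.
elim: w x => [|l w IH] x; first by rewrite multiply_by_word_nil.
rewrite [all _ _]/= eq_sym => /andP[jl jw] gx; rewrite (multiply_by_word_cons _ jl) //.
exact/IH/apply_move_generating.
Qed.

(** Peeling off the first letter covers the set for [L.+1] by [A] and, for each of the finitely many
    letters, the preimage under one move of the set for [L]. *)
Lemma boundary_bounded_word_preimage L j A :
  boundary_bounded A -> boundary_bounded (word_preimage L j A).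
Proof.
move=> nA; elim: L => [|L IH].
  apply: boundary_boundedS nA => x [w [sw _ Aw]].
  by move: sw Aw; rewrite leqn0 size_eq0 => /eqP->; rewrite multiply_by_word_nil.
have : boundary_bounded [set x | exists l : letter,
    exists jl : j != l.1, word_preimage L j A (apply_move (move_R jl l.2) x)].
  apply: boundary_bounded_exists => l; have [jl|jl] := pselect (j != l.1).
    apply: boundary_boundedS (boundary_bounded_move (move_R jl l.2) IH) => x [jl'].
    by rewrite (bool_irrelevance jl' jl).
  by apply: boundary_boundedS (@boundary_bounded0 G n) => x [jl']; case: jl.
move=> /(boundary_boundedU nA); apply: boundary_boundedS => x [w [szw jw Aw]].
case: w szw jw Aw => [|l w] szw jw Aw.
  by left; rewrite multiply_by_word_nil in Aw.
right; exists l; move: jw => /= /andP[]; rewrite eq_sym => jl jw; exists jl.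
by exists w; split=> //; rewrite -multiply_by_word_cons.
Qed.

Lemma generating_tuple_generates x : generating_tuple x -> @generates n G x.
Proof.
move=> gx B sB xB y; have : [set: G] y by [].
rewrite -gx; apply; split=> // _ [k _ <-]; exact: xB.
Qed.

Lemma generates_morph (H : groupType) (f : {multiplicative G -> H}) (x : 'I_n -> G) :
  set_surj setT setT f -> generates x -> generates (f \o x).
Proof.
move=> fsurj gx B sB xB y; have [z _ <-] := fsurj y I.
exact: (gx (f @^-1` B) (is_subgroup_preimage f sB) xB).
Qed.

End WordMoves.

(** * Few entries generate the finite quotient *)

Section SmallGeneratingSubset.
Local Open Scope group_scope.
Variables (n : nat) (H : groupType) (h : 'I_n -> H) (N : set H) (i : nat).
Variable c : H -> 'I_i.
Hypotheses (hgen : generates h) (nN : normal_subgroup N).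
Hypothesis cN : forall x y, c x = c y <-> N (x^-1 * y).

Lemma coset_codeMl g x y : c x = c y <-> c (g * x) = c (g * y).
Proof. by rewrite !cN invgM -!mulgA mulKg. Qed.

Lemma coset_codeMr g x y : c x = c y -> c (x * g) = c (y * g).
Proof.
move=> /cN xy; apply/cN; rewrite invgM !mulgA -[_ * x^-1 * y]mulgA.
exact: nN.2.
Qed.

Lemma coset_codeV x y : c x = c y -> c x^-1 = c y^-1.
Proof.
move=> /(coset_codeMr x^-1); rewrite mulgV => /(coset_codeMl y^-1).
by rewrite mulg1 mulKg.
Qed.

Lemma coset_codeM x y x' y' : c x = c y -> c x' = c y' -> c (x * x') = c (y * y').
Proof. by move=> /(coset_codeMr x') -> /(coset_codeMl y). Qed.

Definition generates_mod (J : {set 'I_n}) : Prop :=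
  forall y, exists2 w, all (fun l : 'I_n * bool => l.1 \in J) w & c (eval_word h w) = c y.

(* A generator outside the subgroup generated by [N] and the [h j], [j] in [J],
   at least doubles the number of cosets of [N] it contains. *)
Lemma ex_small_generates_mod : exists2 J : {set 'I_n}, (2 ^ #|J| <= i)%N & generates_mod J.
Proof.
pose reached (J : {set 'I_n}) y :=
  exists2 w, all (fun l : 'I_n * bool => l.1 \in J) w & c (eval_word h w) = y.
pose E (J : {set 'I_n}) : {set 'I_i} := [set y | `[< reached J y >]]%SET.
pose P (J : {set 'I_n}) := (2 ^ #|J| <= #|E J|)%N.
have P0 : P finset.set0.
  rewrite /P cards0 expn0 card_gt0; apply/finset.set0Pn; exists (c 1).
  by rewrite inE; apply/asboolP; exists [::].
have [J /maxsetP[PJ maxJ] _] := maxset_exists P0.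
have hJ k : reached J (c (h k)).
  apply: contrapT => nk.
  have kJ : k \notin J.
    apply/negP => kJ; apply: nk; exists [:: (k, true)]; rewrite /= ?kJ //.
    by rewrite mulg1.
  suff /maxJ : P (k |: J)%SET.
    by move=> /(_ (finset.subsetUr _ _)) kJE; rewrite -kJE finset.setU11 in kJ.
  have /choice[g gP] e : exists y, (exists y', c y' = e) -> c y = e.
    have [[y ye]|] := pselect (exists y', c y' = e); first by exists y.
    by exists 1.
  (* The reached cosets translated by [h k]: as many as in [E J] and disjoint from them, so that
     adding [k] to [J] doubles the count. *)
  pose F := [set c (h k * g e) | e in E J]%SET.
  have FE : #|F| = #|E J|.
    apply: card_in_imset => e e'; rewrite !inE => -[w _ we] [w' _ we'].
    move=> /(iffRL (coset_codeMl _ _ _)).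
    by rewrite !gP //; [exists (eval_word h w')|exists (eval_word h w)].
  rewrite /P cardsU1 kJ expnD expn1 mul2n -addnn.
  apply: leq_trans (leq_add PJ PJ) _; rewrite -[X in (_ + X <= _)%N]FE -cardsUI.
  rewrite (_ : _ :&: _ = finset.set0) ?cards0 ?addn0; last first.
    apply/setP => e; rewrite !inE; apply/negbTE/negP => /andP[/asboolP[w wJ we]].
    move=> /imsetP[e']; rewrite inE => /asboolP[w' wJ' we'] eE; apply: nk.
    (* A coset common to [E J] and [F] would put [h k] itself in a reached coset. *)
    exists (w ++ inv_word w'); first by rewrite all_cat wJ all_inv_word.
    rewrite eval_word_cat eval_inv_word -[h k](mulgK (g e')).
    apply: coset_codeM; first by rewrite we eE.
    by apply: coset_codeV; rewrite gP //; exists (eval_word h w').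
  apply/subset_leq_card/fintype.subsetP => e; rewrite !inE => /orP[/asboolP[w wJ we]|].
    exists w => //; apply: sub_all wJ => l lJ.
    by rewrite inE lJ orbT.
  move=> /imsetP[e']; rewrite inE => /asboolP[w wJ we] ->.
  exists ((k, true) :: w).
    rewrite /= finset.setU11; apply: sub_all wJ => l lJ; by rewrite inE lJ orbT.
  by apply: (iffLR (coset_codeMl _ _ _)); rewrite we gP //; exists (eval_word h w).
exists J.
  by rewrite -[i]card_ord; apply: leq_trans PJ (max_card _).
move=> y; apply: (hgen (B := [set y | reached J (c y)])); last exact: hJ.
split=> [|x z [w wJ wx] [w' wJ' wz]]; first by exists [::].
exists (w ++ inv_word w'); first by rewrite all_cat wJ all_inv_word.
by rewrite eval_word_cat eval_inv_word; apply: coset_codeM => //; exact: coset_codeV.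
Qed.

(** There are only [i] codes, so [i.+1] words with distinct codes are impossible and words of length
    at most [i] reach everything. *)
Lemma generates_mod_short J : generates_mod J ->
  forall y, exists w, [/\ (size w <= i)%N, all (fun l => l.1 \in J) w &
    c (eval_word h w) = c y].
Proof.
move=> hJ y.
have [[s [sz _ us]]|short] := @ball_growth n H h (fun l => l.1 \in J) _ c i
  (fun g x y => (coset_codeMl g x y).1).
  by have := max_card (mem [seq c (eval_word h w) | w <- s]);
    rewrite card_ord (card_uniqP us) size_map sz ltnn.
by have [w wJ wy] := hJ y; have [w' [sw Jw wE]] := short w wJ; exists w'; rewrite wE.
Qed.

End SmallGeneratingSubset.

(** * Boundary boundedness of the generating tuples *)

Section BoundaryBoundedGenerating.
Import Order.TTheory GRing.Theory Num.Theory.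
Local Open Scope group_scope.
Variables (G H : groupType) (f : {multiplicative G -> H}) (n : nat).
Local Notation tuples := {ffun 'I_n -> G}.
Variables (N : set H) (d : nat) (phi : 'rV[int]_d -> H).
Hypothesis phiD : forall u v, phi (u + v)%R = phi u * phi v.
Hypothesis phi_inj : injective phi.
Hypothesis phiN : range phi = N.

Let phi0 : phi 0%R = 1.
Proof. by apply: (@mulgI _ (phi 0%R)); rewrite -phiD GRing.addr0 mulg1. Qed.

Let phiNN u : phi (- u)%R = (phi u)^-1.
Proof. by apply: (@mulgI _ (phi u)); rewrite -phiD GRing.addrN mulgV phi0. Qed.

Section Pair.
Variables (j1 j2 : 'I_n) (j12 : j1 != j2).

Let j21 : j2 != j1. Proof. by rewrite eq_sym. Qed.

Definition vector_pair (Q : 'rV[int]_d -> 'rV[int]_d -> Prop) : set tuples :=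
  [set x | exists u v, [/\ f (x j1) = phi u, f (x j2) = phi v & Q u v]].

Lemma vector_pairS (Q Q' : 'rV[int]_d -> 'rV[int]_d -> Prop) :
  (forall u v, Q u v -> Q' u v) -> vector_pair Q `<=` vector_pair Q'.
Proof. by move=> QQ' x [u [v [xu xv /QQ']]]; exists u, v. Qed.

Lemma vector_pair_R12 Q x : vector_pair (fun u v => Q (u + v)%R v) x ->
  vector_pair Q (apply_move (move_R j12 true) x).
Proof.
move=> [u [v [xu xv q]]]; exists (u + v)%R, v.
by rewrite !ffunE eqxx (negbTE j21) gmulfM xu xv phiD.
Qed.

Lemma vector_pair_R21 Q x : vector_pair (fun u v => Q u (v + u)%R) x ->
  vector_pair Q (apply_move (move_R j21 true) x).
Proof.
move=> [u [v [xu xv q]]]; exists u, (v + u)%R.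
by rewrite !ffunE eqxx (negbTE j12) gmulfM xu xv phiD.
Qed.

Lemma vector_pair_I1 Q x : vector_pair (fun u v => Q (- u)%R v) x ->
  vector_pair Q (apply_move (move_I j1) x).
Proof.
move=> [u [v [xu xv q]]]; exists (- u)%R, v.
by rewrite !ffunE eqxx (negbTE j21) multiplicativeV xu xv phiNN.
Qed.

Lemma vector_pair_I2 Q x : vector_pair (fun u v => Q u (- v)%R) x ->
  vector_pair Q (apply_move (move_I j2) x).
Proof.
move=> [u [v [xu xv q]]]; exists u, (- v)%R.
by rewrite !ffunE eqxx (negbTE j12) multiplicativeV xu xv phiNN.
Qed.

(* The two shears map the open positive quadrant into its two disjoint halves
   on either side of the diagonal. *)
Lemma boundary_bounded_quadrant (k : 'I_d) :
  boundary_bounded (vector_pair (fun u v => 0 < u ord0 k /\ 0 < v ord0 k)%R).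
Proof.
apply: (@boundary_bounded_paradoxical _ _ _
  (vector_pair (fun u v => v ord0 k < u ord0 k)%R) (move_R j12 true) (move_R j21 true)) => x Wx.
- split; apply: vector_pair_R12; apply: vector_pairS Wx => u v [u0 v0]; rewrite !mxE.
    by split=> //; exact: addr_gt0.
  by rewrite ltrDr.
- split.
    apply: vector_pair_R21; apply: vector_pairS Wx => u v [u0 v0]; rewrite !mxE.
    by split=> //; exact: addr_gt0.
  move: Wx => [u [v [xu xv [u0 v0]]]] [u' [v' []]].
  rewrite !ffunE eqxx (negbTE j12) gmulfM xu xv -phiD => /phi_inj <- /phi_inj <-.
  by rewrite !mxE gtrDr ltNge ltW.
Qed.

(** Inverting one or both entries moves each of the four open quadrants to the positive one. *)
Lemma boundary_bounded_axes_complement (k : 'I_d) :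
  boundary_bounded (vector_pair (fun u v => u ord0 k != 0 /\ v ord0 k != 0)%R).
Proof.
have b := boundary_bounded_quadrant k.
have b1 := boundary_bounded_move (move_I j1) b.
have b2 := boundary_bounded_move (move_I j2) b.
have b12 := boundary_bounded_move (move_I j1) b2.
apply: boundary_boundedS (boundary_boundedU (boundary_boundedU b b1) (boundary_boundedU b2 b12)).
move=> x [u [v [xu xv [u0 v0]]]].
case: (ltrgt0P (u ord0 k)) u0 => // u0 _; case: (ltrgt0P (v ord0 k)) v0 => // v0 _.
- by left; left; exists u, v.
- by right; left; apply: vector_pair_I2; exists u, v; rewrite mxE oppr_gt0.
- by left; right; apply: vector_pair_I1; exists u, v; rewrite mxE oppr_gt0.
- right; right; apply: vector_pair_I2; apply: vector_pair_I1; exists u, v.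
  by rewrite !mxE !oppr_gt0.
Qed.

(** Some coordinate of [u] is nonzero; if that coordinate of [v] vanishes, adding [u] to [v] makes
    both nonzero. *)
Lemma boundary_bounded_nonzero :
  boundary_bounded (vector_pair (fun u v => u != 0)%R).
Proof.
have : boundary_bounded [set x | exists k, vector_pair (fun u v => u ord0 k != 0)%R x].
  apply: boundary_bounded_exists => k.
  have b := boundary_bounded_axes_complement k.
  have b2 := boundary_bounded_move (move_R j21 true) b.
  apply: boundary_boundedS (boundary_boundedU b b2) => x [u [v [xu xv u0]]].
  have [v0|v0] := eqVneq (v ord0 k) 0%R; last by left; exists u, v.
  right; apply: vector_pair_R21; exists u, v; split=> //; split=> //.
  by rewrite mxE v0 GRing.add0r.
apply: boundary_boundedS => x [u [v [xu xv u0]]].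
have [k uk] : exists k, (u ord0 k != 0)%R.
  apply/existsP; rewrite -negb_forall; apply: contra u0 => /forallP u0.
  by apply/eqP/rowP => k; rewrite mxE; apply/eqP.
by exists k, u, v.
Qed.

Variables (i : nat) (c : H -> 'I_i).
Hypothesis fsurj : set_surj setT setT f.
Hypothesis d0 : (0 < d)%N.
Hypothesis cN : forall x y, c x = c y <-> N (x^-1 * y).

Lemma infinite_codomain : ~ finite_set [set: H].
Proof.
move=> finH; case: d d0 phi phiD phi_inj => // e _ psi psiD psi_inj.
pose g (k : nat) := psi (delta_mx ord0 ord0 *+ k)%R.
have ginj : injective g.
  move=> k l /psi_inj /rowP /(_ ord0); rewrite !mulmxnE !mxE eqxx /= !natz.
  by move=> [].
apply: infinite_nat; have -> : [set: nat] = g @^-1` setT by [].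
by apply: finite_preimage => //; move=> ? ? _ _; exact: ginj.
Qed.

(* If [f (x j1) = 1], the remaining entries of [x] generate [H] under [f];
   as [H] is infinite, two distinct words of length at most [i] have images in
   the same coset of [N], and multiplying [x j1] by their quotient makes it a
   nontrivial element of [N]. *)
Lemma boundary_bounded_pair : boundary_bounded
  [set x | generating_tuple x /\ N (f (x j1)) /\ N (f (x j2))].
Proof.
have b := boundary_bounded_nonzero.
(* The bound [i + i] is for the quotient of two words of length at most [i]. *)
apply: boundary_boundedS (boundary_boundedU b (boundary_bounded_word_preimage (i + i) j1 b)).
move=> x [gx [N1 N2]].
move: (N1) (N2); rewrite -{1 2}phiN => -[u _ xu] [v _ xv].
have [u0|u0] := eqVneq u 0%R; last by left; exists u, v.
have x1 : f (x j1) = 1 by rewrite -xu u0 phi0.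
have hgen : generates (f \o x) := generates_morph fsurj (generating_tuple_generates gx).
pose P (l : 'I_n * bool) := l.1 != j1.
have [[s [sz sP us]]|short] := @ball_growth n H (f \o x) P H id i
    (fun g x y => @congr1 _ _ (fun z => g * z) x y); last first.
  exfalso; apply: infinite_codomain.
  have : finite_set (range (fun w : i.-bseq ('I_n * bool) => eval_word (f \o x) w)).
    exact/finite_image/finite_finset.
  apply: sub_finite_set => y _; have [w <-] := generatesP hgen y.
  have [|w' [sw' _ wE]] := short [seq l <- w | P l]; first exact: filter_all.
  by exists (Bseq sw'); rewrite //= wE eval_word_filter.
have [w1 [w2 [w1s w2s cw w12]]] : exists w1 w2, [/\ w1 \in s, w2 \in s,
    c (eval_word (f \o x) w1) = c (eval_word (f \o x) w2) &
    eval_word (f \o x) w1 != eval_word (f \o x) w2].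
  (* Otherwise the [i.+1] distinct values would have distinct codes in ['I_i]. *)
  apply: contrapT => nw; set t := [seq _ | w <- s] in us.
  have ct : uniq (map c t).
    rewrite map_inj_in_uniq // => _ _ /mapP[w1 w1s ->] /mapP[w2 w2s ->] cw.
    by apply/eqP/negPn/negP => w12; apply: nw; exists w1, w2.
  have := max_card (mem (map c t)).
  by rewrite card_ord (card_uniqP ct) !size_map sz ltnn.
have /andP[sw1 Pw1] := allP sP _ w1s; have /andP[sw2 Pw2] := allP sP _ w2s.
right; exists (inv_word w1 ++ w2); split.
- by rewrite size_cat size_inv_word leq_add.
- by rewrite all_cat (all_inv_word (fun k => k != j1)) Pw1.
have : N (eval_word (f \o x) (inv_word w1 ++ w2)).
  by rewrite eval_word_cat eval_inv_word; apply/cN.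
rewrite -phiN => -[u' _ u'E]; exists u', v; rewrite !ffunE eqxx (negbTE j21).
split=> //; first by rewrite gmulfM x1 mul1g eval_word_morph.
apply: contra w12 => /eqP u'0; move: u'E.
rewrite u'0 phi0 eval_word_cat eval_inv_word => E.
by apply/eqP; rewrite -[LHS]mulg1 E mulVKg.
Qed.

End Pair.

Variables (i : nat) (c : H -> 'I_i).
Hypothesis fsurj : set_surj setT setT f.
Hypothesis nN : normal_subgroup N.
Hypothesis d0 : (0 < d)%N.
Hypothesis cN : forall x y, c x = c y <-> N (x^-1 * y).
Hypothesis i_small : (4 * i <= 2 ^ n)%N.

Lemma boundary_bounded_generating :
  boundary_bounded [set x : tuples | generating_tuple x].
Proof.
pose Y j1 j2 := [set x : tuples | generating_tuple x /\ N (f (x j1)) /\ N (f (x j2))].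
have : boundary_bounded [set x | exists j : 'I_n * 'I_n, j.1 != j.2 /\
    word_preimage i j.1 (word_preimage i j.2 (Y j.1 j.2)) x].
  apply: boundary_bounded_exists => -[j1 j2] /=.
  have [j12|j12] := pselect (j1 != j2); last first.
    by apply: boundary_boundedS (@boundary_bounded0 G n) => x [].
  apply: boundary_boundedS (boundary_bounded_word_preimage i j1
    (boundary_bounded_word_preimage i j2 (boundary_bounded_pair j12 fsurj d0 cN))).
  by move=> x [].
apply: boundary_boundedS => x /= gx.
have hgen : generates (f \o x) := generates_morph fsurj (generating_tuple_generates gx).
have [J Ji hJ] := ex_small_generates_mod hgen nN cN.
(* From [2 ^ #|J| <= i] and [4 * i <= 2 ^ n], at least two indices lie outside [J]. *)
have [j1 [j2 [j1J j2J j12]]] : exists j1 j2, [/\ j1 \notin J, j2 \notin J & j1 != j2].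
  have : (1 < #|~: J|)%N.
    rewrite cardsCs finset.setCK card_ord ltn_subRL addn1.
    have : (2 ^ (2 + #|J|) <= 2 ^ n)%N.
      by apply: leq_trans i_small; rewrite expnD leq_mul2l.
    by rewrite leq_exp2l.
  by move=> /card_gt1P[j1 [j2 []]]; rewrite !finset.inE => ? ? ?; exists j1, j2.
(* The word represents the coset of the inverse of [f (x j)]. *)
have short j : exists w, [/\ (size w <= i)%N,
    all (fun l => l.1 \in J) w & N (f (x j * eval_word x w))].
  have [w [sw wJ /esym/cN wE]] := generates_mod_short cN hJ (f (x j))^-1.
  by exists w; rewrite gmulfM eval_word_morph -[f (x j)]invgK.
have avoid j w : j \notin J -> all (fun l : 'I_n * bool => l.1 \in J) w ->
    all (fun l => l.1 != j) w.
  by move=> jJ; apply: sub_all => l lJ; apply: contraNneq jJ => <-.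
have [w1 [sw1 w1J Nw1]] := short j1; have [w2 [sw2 w2J Nw2]] := short j2.
exists (j1, j2); split=> //=; exists w1; split=> //; first exact: avoid.
exists w2; split=> //; first exact: avoid.
split; first by do 2![apply: generating_multiply_by_word; first exact: avoid].
(* The letters of [w2] lie in [J], so changing the entry [j1] does not affect its value. *)
have xw2 : eval_word (multiply_by_word x j1 w1) w2 = eval_word x w2.
  apply: (@eq_in_eval_word _ _ _ _ (mem J) _ _ w2J) => k kJ; rewrite ffunE.
  by case: eqP => // kj; case/negP: j1J; rewrite -kj.
by rewrite !ffunE !eqxx xw2 (negbTE j12) eq_sym (negbTE j12).
Qed.

End BoundaryBoundedGenerating.

(** * From boundary boundedness to nonamenability *)

Section Nonamenable.
Import Order.TTheory GRing.Theory Num.Theory.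
Variables (R : realType) (G : groupType) (n : nat).
Local Notation tuples := {ffun 'I_n -> G}.
Implicit Type S : {fset tuples}.

(** Needed because [fset_set] of an infinite boundary would be empty. *)
Lemma finite_incident S : finite_set
  [set e : tuples * nielsen_move n | e.1 \in S \/ apply_move e.2 e.1 \in S].
Proof.
have fin1 : finite_set [set e : tuples * nielsen_move n | e.1 \in S].
  apply: (@sub_finite_set _ _ ([set` S] `*` [set: nielsen_move n])).
    by move=> e /= eS; split.
  by apply: finite_setX; [exact: finite_fset|exact: finite_finset].
pose g (e : tuples * nielsen_move n) := (apply_move e.2 e.1, e.2).
have ginj : injective g.
  by move=> [x m] [y m'] [xy mm']; rewrite -mm' in xy *; congr pair; exact: apply_move_inj xy.
have fin2 : finite_set (g @^-1` [set e | e.1 \in S]).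
  by apply: finite_preimage fin1 => ? ? _ _; exact: ginj.
have fin12 : finite_set ([set e | e.1 \in S] `|` g @^-1` [set e | e.1 \in S]).
  by rewrite finite_setU.
by apply: sub_finite_set fin12 => e.
Qed.

(** The boundary is sorted by moves; for each move, the vertices it takes out of [S] give distinct
    boundary edges. *)
Lemma outgoing_le_boundary (x : tuples) S :
  [set` S] `<=` vertices (component (nielsen_graph G n) x) ->
  (outgoing S <=
   #|` fset_set (edge_boundary (component (nielsen_graph G n) x) S)|)%N.
Proof.
move=> Sx; set B := fset_set _.
have BE e : e.1 \in S -> apply_move e.2 e.1 \notin S -> e \in B.
  move=> eS emS; rewrite in_fset_set; last first.
    apply: sub_finite_set (finite_incident S) => e' [_] /=.
    by case: (e'.1 \in S) => /=; [left|rewrite negbK; right].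
  have [ge ce] := Sx _ eS.
  by apply/mem_set; split=> /=; [split|rewrite eS (negbTE emS)].
rewrite -[X in (_ <= X)%N]sum1_size (partition_big snd xpredT) //=.
apply: leq_sum => m _; rewrite sum1_count -size_filter.
set F := [fset y in S | _]%fset.
rewrite -[X in (X <= _)%N](size_map (fun y => (y, m))).
apply: uniq_leq_size.
  by rewrite map_inj_uniq ?fset_uniq // => y z [].
move=> _ /mapP[y yF ->]; move: yF; rewrite !inE /= => /andP[yS ymS].
by rewrite mem_filter eqxx /=; exact: BE.
Qed.

Lemma nonamenable_boundary_bounded :
  boundary_bounded [set x : tuples | generating_tuple x] ->
  ~ amenable R (nielsen_graph G n).
Proof.
move=> [C CP] [x gx].
set X := component _ x.
have bound S : [set` S] `<=` vertices X ->
    (#|` S| <= C * #|` fset_set (edge_boundary X S)|)%N.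
  move=> SX; apply: leq_trans (_ : C * outgoing S <= _)%N; last first.
    by rewrite leq_mul2l outgoing_le_boundary ?orbT.
  apply: leq_trans (CP S); apply/fsubset_leq_card/fsubsetP => y yS.
  by rewrite !inE /= yS; apply/asboolP; have [] := SX y yS.
have Xx : vertices X x by split=> //; exact: Relation_Operators.rst_refl.
move=> [finX|cheeger0].
  (* A finite component has no boundary in itself, so the bound would make it empty, although it
     contains [x]. *)
  have SX : [set` fset_set (vertices X)] = vertices X by rewrite fset_setK.
  have := bound (fset_set (vertices X)).
  rewrite SX (_ : edge_boundary X _ = set0); last first.
    apply/seteqP; split=> // e [Xe]; have [sX tX] := edges_ends Xe.
    by rewrite !in_fset_set // (mem_set sX) (mem_set tX).
  rewrite fset_set0 cardfs0 muln0 leqn0 cardfs_eq0 => /(_ (fun _ => id)) /eqP X0.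
  by have : vertices X x by []; rewrite -SX X0.
(* [C.+1] replaces [C], which may be zero, so that the lower bound is positive. *)
have : ((C.+1%:R)^-1 <= cheeger R X)%R.
  apply: lb_le_inf.
    (* The infimum is over a nonempty set: the singleton of [x] contributes. *)
    exists (#|` fset_set (edge_boundary X [fset x]%fset)|%:R / #|` [fset x]%fset|%:R)%R.
    exists [fset x]%fset => //; split; last by move=> y /=; rewrite inE => /eqP->.
    by apply/fset0Pn; exists x; rewrite inE.
  move=> _ [S [S0 SX] <-].
  have S0' : (0 < #|` S|)%N by rewrite cardfs_gt0.
  rewrite ler_pdivlMr ?ltr0n // mulrC ler_pdivrMr ?ltr0n // -natrM ler_nat mulnC.
  by apply: leq_trans (bound S SX) _; rewrite leq_mul2r leqnSn orbT.
by rewrite cheeger0 leNgt invr_gt0 ltr0n.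
Qed.

(** The empty tuple generates only the trivial group. *)
Lemma rank_gt0 : finitely_generated G -> infinite_set [set: G] -> (0 < rank G)%N.
Proof.
move=> fg infG; rewrite /rank; case: pselect => // fg'; case: ex_minnP => -[|//].
move=> /asboolP[g gG] _; exfalso; apply: infG; rewrite -gG.
apply: (@sub_finite_set _ _ [set 1%g]); last exact: finite_set1.
apply: smallest_sub; last by move=> y [[]].
by split=> // _ _ -> ->; rewrite mulgV.
Qed.

(** As [r] is at least 1, the hypothesis gives [2 + log2 i <= n], the logarithmic form of the claim;
    the summand 2 provides the two spare entries. *)
Lemma four_mul_le_exp2 (r i : nat) : (0 < r)%N -> (0 < i)%N ->
  (r%:R + ln i%:R / ln 2 + 1 <= n%:R :> R)%R -> (4 * i <= 2 ^ n)%N.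
Proof.
move=> r0 i0 le_n.
have ln2 : (0 < ln 2 :> R)%R by rewrite ln_gt0 // ltr1n.
have i0R : (0 < i%:R :> R)%R by rewrite ltr0n.
have lnE : ln (4 * i%:R : R) = (ln 2 * (2 + ln i%:R / ln 2))%R.
  have -> : (4 : R) = 2 * 2 by rewrite -natrM.
  rewrite !lnM ?posrE ?mulr_gt0 ?ltr0n // mulrDr [(ln 2 * (_ / _))%R]mulrC.
  by rewrite divfK ?gt_eqF // mulr_natr mulr2n.
rewrite -(ler_nat R) natrM natrX -ler_ln ?posrE ?mulr_gt0 ?exprn_gt0 ?ltr0n //.
rewrite lnE lnXn ?ltr0n // -[leRHS]mulr_natr ler_pM2l //.
by apply: le_trans le_n; rewrite [leRHS]addrAC lerD2r natr1 ler_nat.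
Qed.

End Nonamenable.

Theorem theorem1p2 (R : realType) (G : groupType)
  (G_infinite : infinite_set [set: G])
  (G_fg : finitely_generated G)
  (G_ea : elementary_amenable G) :
  exists (H : groupType) (f : {multiplicative G -> H}) (N : set H) (d i : nat),
    set_surj setT setT f /\
    normal_subgroup N /\
    (1 <= d)%N /\ isomorphic_to_Zn d N /\
    (1 <= i)%N /\ has_index N i /\
    forall n : nat,
      (rank G)%:R + ln i%:R / ln 2 + 1 <= n%:R :> R ->
      ~ amenable R (nielsen_graph G n).
Proof.
have fgG := finitely_generated_set_fg G_fg.
have vG : infinite_virtual_abelianization G.
  (* [G] is a subquotient of itself through equality. *)
  apply: (elementary_amenable_subquotients G_ea (r := fun x y => x = y)) => //.
    by split=> [//|x _ x' _ -> -> //|y|y <-//]; exists y.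
  by move=> /finite_index1.
have [H [f [N [d [fsurj nN iN d0 dN]]]]] := virtually_free_abelian_quotient fgG vG.
have [i i0 Ni] := finite_index_has_index nN.1 iN.
exists H, f, N, d, i; do 6!split=> //.
move=> n le_n; apply: nonamenable_boundary_bounded.
have [phi [phiD phi_inj phiN]] := dN.
have [c cN] := has_index_code nN.1 Ni.
apply: (boundary_bounded_generating phiD phi_inj phiN fsurj nN d0 cN).
exact: four_mul_le_exp2 (rank_gt0 G_fg G_infinite) i0 le_n.
Qed.
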